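(* Let $C$ be an algebraically closed field of characteristic zero. The functor $$\gamma\,eul:\mathbf{End}^u\longrightarrow\mathbf{MC}_{\rm rs}^u$$ is an equivalence of categories, where $\mathbf{End}^u$ and $\mathbf{MC}_{\rm rs}^u$ are the full subcategories of unipotent objects of $\mathbf{End}$ and of $\mathbf{MC}_{\rm rs}(C((x))/C)$ respectively.
   Context: $\vartheta=x\frac{d}{dx}$ on $C[[x]]$ and $C((x))$. $\mathbf{End}$ is the category of pairs $(V,A)$ with $V$ a finite-dimensional $C$-space and $A\in\mathrm{End}_C(V)$; arrows $(V,A)\to(V',A')$ are $C$-linear $\varphi:V\to V'$ with $A'\varphi=\varphi A$. It is an abelian tensor category (representations of the one-dimensional Lie algebra), with unit object $(C,0)$ and $(V,A)\otimes(V',A')=(V\otimes V',A\otimes\mathrm{id}+\mathrm{id}\otimes A')$. $\mathbf{MC}(C((x))/C)$: pairs $(M,\nabla)$ with $M$ a finite-dimensional $C((x))$-space and $\nabla$ a $C$-linear map with $\nabla(fm)=\vartheta(f)m+f\nabla(m)$; arrows are $C((x))$-linear maps commuting with $\nabla$. $\mathbf{MC}_{\log}(C[[x]]/C)$: the same with finitely generated $C[[x]]$-modules. $\gamma$ is the functor $\mathbf{MC}_{\log}(C[[x]]/C)\to\mathbf{MC}(C((x))/C)$ inverting $x$, and $\mathbf{MC}_{\rm rs}(C((x))/C)$ is the full subcategory of objects isomorphic to some $\gamma(\mathcal M)$; its unit object is $(C((x)),\vartheta)$. $eul(V,A)=(C[[x]]\otimes_CV,D_A)$ with $D_A(f\otimes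 v)=\vartheta(f)\otimes v+f\otimes Av$. An object of an abelian tensor category is unipotent if it has a finite filtration whose graded pieces are isomorphic to the unit object. *)

(* Defs.v *)
From HB Require Import structures.
From mathcomp Require Import all_boot all_order all_algebra.
From mathcomp Require Import boolp zify.

Set Implicit Arguments.
Unset Strict Implicit.
Unset Printing Implicit Defensive.

Import GRing.Theory.
Local Open Scope ring_scope.
Local Open Scope quotient_scope.

Record category := Category {
  obj :> Type;
  hom : obj -> obj -> Type;
  idm : forall a, hom a a;
  comp : forall a b c, hom b c -> hom a b -> hom a c;
  comp_idl : forall a b (f : hom a b), comp (idm b) f = f;
  comp_idr : forall a b (f : hom a b), comp f (idm a) = f;
  compA : forall a b c d (h : hom c d) (g : hom b c) (f : hom a b),
    comp h (comp g f) = comp (comp h g) f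
}.
Arguments hom {_} _ _.
Arguments idm {_} a.
Arguments comp {_ a b c} _ _.

Record functor (C D : category) := Functor {
  fobj :> C -> D;
  fmap : forall a b : C, hom a b -> hom (fobj a) (fobj b);
  fmap_id : forall a : C, fmap (idm a) = idm (fobj a);
  fmap_comp : forall (a b c : C) (g : hom b c) (f : hom a b),
    fmap (comp g f) = comp (fmap g) (fmap f)
}.
Arguments fmap {C D} _ {a b} _.

Definition functor_id (C : category) : functor C C :=
  @Functor C C (fun a => a) (fun _ _ f => f)
    (fun _ => erefl) (fun _ _ _ _ _ => erefl).

Section FunctorComp.
Variables (C D E : category) (G : functor D E) (F : functor C D).

Fact functor_comp_id (a : C) : fmap G (fmap F (idm a)) = idm (G (F a)).
Proof. by rewrite !fmap_id. Qed.

Fact functor_comp_comp (a b c : C) (g : hom b c) (f : hom a b) :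
  fmap G (fmap F (comp g f)) = comp (fmap G (fmap F g)) (fmap G (fmap F f)).
Proof. by rewrite !fmap_comp. Qed.

Definition functor_comp : functor C E :=
  @Functor C E (fun a => G (F a)) (fun a b f => fmap G (fmap F f))
    functor_comp_id functor_comp_comp.
End FunctorComp.

Definition is_iso (C : category) (a b : C) (f : hom a b) : Prop :=
  exists g : hom b a, comp g f = idm a /\ comp f g = idm b.

Definition isomorphic (C : category) (a b : C) : Prop :=
  exists f : hom a b, is_iso f.

Definition naturally_isomorphic (C D : category) (F G : functor C D) : Prop :=
  exists eta : forall a : C, hom (F a) (G a),
    (forall a, is_iso (eta a)) /\
    (forall (a b : C) (f : hom a b),
       comp (eta b) (fmap F f) = comp (fmap G f) (eta a)).

Definition is_equivalence (C D : category) (F : functor C D) : Prop :=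
  exists G : functor D C,
    naturally_isomorphic (functor_comp G F) (functor_id C) /\
    naturally_isomorphic (functor_comp F G) (functor_id D).

Section FullSubcategory.
Variables (C : category) (P : C -> Prop).

Definition full_subcategory : category :=
  @Category {a : C | P a} (fun a b => hom (sval a) (sval b))
    (fun a => idm (sval a)) (fun a b c g f => comp g f)
    (fun a b f => comp_idl f) (fun a b f => comp_idr f)
    (fun a b c d h g f => compA h g f).
End FullSubcategory.

Definition functor_corestrict (C D : category) (F : functor C D)
    (Q : D -> Prop) (FQ : forall a, Q (F a)) :
    functor C (full_subcategory Q) :=
  @Functor C (full_subcategory Q) (fun a => exist _ (F a) (FQ a))
    (fun a b f => fmap F f) (fmap_id F) (fun a b c g f => fmap_comp F g f).

Definition functor_restrict (C D : category) (F : functor C D)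
    (P : C -> Prop) (Q : D -> Prop) (FPQ : forall a, P a -> Q (F a)) :
    functor (full_subcategory P) (full_subcategory Q) :=
  @Functor (full_subcategory P) (full_subcategory Q)
    (fun a => exist _ (F (sval a)) (FPQ (sval a) (svalP a)))
    (fun a b f => fmap F f) (fun a => fmap_id F (sval a))
    (fun a b c g f => fmap_comp F g f).

Section Unipotent.
Variable C : category.

Definition is_mono (a b : C) (f : hom a b) : Prop :=
  forall (c : C) (u v : hom c a), comp f u = comp f v -> u = v.

Definition is_zero_object (z : C) : Prop :=
  forall a : C, (exists! f : hom a z, True) /\ (exists! f : hom z a, True).

(* In the presence of a zero object, this characterizes the zero arrow. *)
Definition is_zero_arrow (a b : C) (f : hom a b) : Prop :=
  exists (z : C) (g : hom z b) (h : hom a z), is_zero_object z /\ f = comp g h.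

Definition is_cokernel (a b q : C) (f : hom a b) (p : hom b q) : Prop :=
  is_zero_arrow (comp p f) /\
  forall (c : C) (g : hom b c), is_zero_arrow (comp g f) ->
    exists! h : hom q c, comp h p = g.

(* A finite filtration of X is a chain of monomorphisms                        *)
(*   0 = fil 0 -> fil 1 -> ... -> fil n = X,                                   *)
(* and the graded pieces are the cokernels fil k.+1 / fil k. The sequence fil  *)
(* is total on nat, but its terms beyond n play no role. The notion is meant   *)
(* for an abelian tensor category with unit object [one]; of the tensor        *)
(* structure it only involves [one].                                           *)
Definition unipotent (one X : C) : Prop :=
  exists (n : nat) (fil : nat -> C) (i : forall k, hom (fil k) (fil k.+1)),
    [/\ is_zero_object (fil 0%N), isomorphic (fil n) X &
        forall k, (k < n)%N ->
          is_mono (i k) /\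
          exists (gr : C) (p : hom (fil k.+1) gr),
            is_cokernel (i k) p /\ isomorphic gr one].
End Unipotent.

Section EndCategory.
Variable C : fieldType.

Record end_obj := EndObj { end_space :> vectType C; end_map : 'End(end_space) }.

Record end_hom (V W : end_obj) := EndHom {
  end_fun :> 'Hom(V, W);
  end_funP : (end_map W \o end_fun = end_fun \o end_map V)%VF
}.

Lemma end_hom_eq (V W : end_obj) (f g : end_hom V W) :
  end_fun f = end_fun g -> f = g.
Proof.
case: f g => [f fP] [g gP] /= efg; rewrite -{}efg in gP *.
by congr EndHom; apply: Prop_irrelevance.
Qed.

Fact end_idP (V : end_obj) : (end_map V \o \1 = \1 \o end_map V)%VF.
Proof. by rewrite comp_lfun1l comp_lfun1r. Qed.

Fact end_compP (U V W : end_obj) (g : end_hom V W) (f : end_hom U V) :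
  (end_map W \o (g \o f) = (g \o f) \o end_map U)%VF.
Proof. by rewrite comp_lfunA end_funP -comp_lfunA end_funP comp_lfunA. Qed.

Definition end_id (V : end_obj) : end_hom V V := EndHom (end_idP V).
Definition end_comp (U V W : end_obj) (g : end_hom V W) (f : end_hom U V) :
  end_hom U W := EndHom (end_compP g f).

Definition EndCat : category.
Proof.
refine (@Category end_obj end_hom end_id end_comp _ _ _).
- by move=> V W f; apply: end_hom_eq; apply: comp_lfun1l.
- by move=> V W f; apply: end_hom_eq; apply: comp_lfun1r.
- by move=> U V W X h g f; apply: end_hom_eq; apply: comp_lfunA.
Defined.

Definition end_unit : EndCat := @EndObj C^o 0.
End EndCategory.

(* Over a field, this says that the space has finite dimension. *)
Definition finitely_generated (R : nzRingType) (M : lmodType R) : Prop :=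
  exists (n : nat) (e : 'I_n -> M),
    forall m : M, exists a : 'I_n -> R, m = \sum_i a i *: e i.

(* R is a C-algebra via iota, with a C-linear derivation theta. *)
Section Connections.
Variables (C : fieldType) (R : comNzRingType).
Variables (iota : C -> R) (theta : R -> R).

Record mc_obj := MCObj {
  mc_mod :> lmodType R;
  mc_nabla : mc_mod -> mc_mod;
  mc_fin : finitely_generated mc_mod;
  mc_Clinear : forall (c : C) (m m' : mc_mod),
    mc_nabla (iota c *: m + m') = iota c *: mc_nabla m + mc_nabla m';
  mc_leibniz : forall (f : R) (m : mc_mod),
    mc_nabla (f *: m) = theta f *: m + f *: mc_nabla m
}.

Record mc_hom (M N : mc_obj) := MCHom {
  mc_fun :> M -> N;
  mc_fun_linear : linear mc_fun;
  mc_fun_nabla : forall m, mc_fun (mc_nabla m) = mc_nabla (mc_fun m)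
}.

Lemma mc_hom_eq (M N : mc_obj) (f g : mc_hom M N) : f =1 g -> f = g.
Proof.
case: f g => [f fl fn] [g gl gn] /= /funext efg; rewrite -{}efg in gl gn *.
by congr MCHom; apply: Prop_irrelevance.
Qed.

Section HomTheory.
Variables (M N : mc_obj) (f : mc_hom M N).

Lemma mc_funD v w : mc_fun f (v + w) = mc_fun f v + mc_fun f w.
Proof. by have := mc_fun_linear f 1 v w; rewrite !scale1r. Qed.

Lemma mc_fun0 : mc_fun f 0 = 0.
Proof. by apply: (addIr (mc_fun f 0)); rewrite -mc_funD !add0r. Qed.

Lemma mc_funZ g w : mc_fun f (g *: w) = g *: mc_fun f w.
Proof. by have := mc_fun_linear f g w 0; rewrite !addr0 mc_fun0 addr0. Qed.

Lemma mc_funB v w : mc_fun f (v - w) = mc_fun f v - mc_fun f w.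
Proof. by rewrite mc_funD -scaleN1r mc_funZ scaleN1r. Qed.

Lemma mc_funMn v n : mc_fun f (v *+ n) = mc_fun f v *+ n.
Proof. by elim: n => [|n IHn]; rewrite ?mc_fun0 // !mulrS mc_funD IHn. Qed.

End HomTheory.

Definition mc_id (M : mc_obj) : mc_hom M M :=
  @MCHom M M id (fun _ _ _ => erefl) (fun _ => erefl).

Fact mc_comp_linear (M N P : mc_obj) (g : mc_hom N P) (f : mc_hom M N) :
  linear (g \o f).
Proof. by move=> a u v /=; rewrite !mc_fun_linear. Qed.

Fact mc_comp_nabla (M N P : mc_obj) (g : mc_hom N P) (f : mc_hom M N) m :
  (g \o f) (mc_nabla m) = mc_nabla ((g \o f) m).
Proof. by rewrite /= !mc_fun_nabla. Qed.

Definition mc_comp (M N P : mc_obj) (g : mc_hom N P) (f : mc_hom M N) :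
  mc_hom M P := MCHom (mc_comp_linear g f) (mc_comp_nabla g f).

Definition MC : category.
Proof.
refine (@Category mc_obj mc_hom mc_id mc_comp _ _ _);
  by move=> *; apply: mc_hom_eq.
Defined.
End Connections.

(* [pseries V] is V[[x]]: the ring C[[x]] for V := C, and C[[x]] (x)_C V for a *)
(* finite-dimensional C-space V; see [pseries_tensor_universal] below.         *)
Record pseries (V : Type) := Pseries { pcoef : nat -> V }.

Lemma pseriesP (V : Type) (s t : pseries V) : pcoef s =1 pcoef t <-> s = t.
Proof. by split=> [|-> //]; case: s t => [s] [t] /= /funext ->. Qed.

HB.instance Definition _ (V : Type) := gen_eqMixin (pseries V).
HB.instance Definition _ (V : Type) := gen_choiceMixin (pseries V).

Section PseriesZmod.
Variable V : zmodType.
Implicit Types s t : pseries V.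

Definition ps_zero : pseries V := Pseries (fun _ => 0).
Definition ps_opp s : pseries V := Pseries (fun n => - pcoef s n).
Definition ps_add s t : pseries V := Pseries (fun n => pcoef s n + pcoef t n).

Fact ps_addA : associative ps_add.
Proof. by move=> s t u; apply/pseriesP => n /=; rewrite addrA. Qed.
Fact ps_addC : commutative ps_add.
Proof. by move=> s t; apply/pseriesP => n /=; rewrite addrC. Qed.
Fact ps_add0 : left_id ps_zero ps_add.
Proof. by move=> s; apply/pseriesP => n /=; rewrite add0r. Qed.
Fact ps_addN : left_inverse ps_zero ps_opp ps_add.
Proof. by move=> s; apply/pseriesP => n /=; rewrite addNr. Qed.

HB.instance Definition _ := GRing.isZmodule.Build (pseries V)
  ps_addA ps_addC ps_add0 ps_addN.

Lemma pcoefD s t n : pcoef (s + t) n = pcoef s n + pcoef t n.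
Proof. by []. Qed.
Lemma pcoef0 n : pcoef (0 : pseries V) n = 0.
Proof. by []. Qed.
Lemma pcoef_sum (I : Type) (r : seq I) (P : pred I) (F : I -> pseries V) n :
  pcoef (\sum_(i <- r | P i) F i) n = \sum_(i <- r | P i) pcoef (F i) n.
Proof. by elim/big_rec2: _ => // i y1 y2 _ <-. Qed.

Definition ps_const (v : V) : pseries V :=
  Pseries (fun n => if n == 0%N then v else 0).

(* x d/dx *)
Definition ps_theta s : pseries V := Pseries (fun n => pcoef s n *+ n).

Lemma pcoef_theta s n : pcoef (ps_theta s) n = pcoef s n *+ n.
Proof. by []. Qed.
End PseriesZmod.

Section PseriesScale.
Variables (R : comNzRingType) (V : lmodType R).
Implicit Types (f g : pseries R) (s t : pseries V).

Definition ps_scale f s : pseries V :=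
  Pseries (fun n => \sum_(i < n.+1) pcoef f i *: pcoef s (n - i)%N).

Lemma ps_scaleDr f s t : ps_scale f (s + t) = ps_scale f s + ps_scale f t.
Proof.
by apply/pseriesP => n /=; rewrite -big_split; apply: eq_bigr => i _; rewrite /= scalerDr.
Qed.
Lemma ps_scaleDl s f g : ps_scale (f + g) s = ps_scale f s + ps_scale g s.
Proof.
by apply/pseriesP => n /=; rewrite -big_split; apply: eq_bigr => i _; rewrite /= scalerDl.
Qed.
Lemma ps_scale_const c s n : pcoef (ps_scale (ps_const c) s) n = c *: pcoef s n.
Proof.
rewrite /= big_ord_recl /= subn0 big1 ?addr0 // => i _.
by rewrite scale0r.
Qed.
End PseriesScale.

Section PseriesScaleA.
Variables (R : comNzRingType) (V : lmodType R).

Lemma sum_shift (F : nat -> V) (i n : nat) : (i <= n)%N ->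
  \sum_(k < n.+1 | (i <= k)%N) F k = \sum_(j < (n - i).+1) F (j + i)%N.
Proof.
move=> le_in; have := big_geq_mkord (op := +%R) (idx := 0) i n.+1 xpredT F.
move=> /= <-; rewrite -subSn //.
by have := @big_addn _ 0 +%R 0 n.+1 i xpredT F; rewrite add0n => ->; apply: big_mkord.
Qed.

Lemma ps_scaleA (f g : pseries R) (s : pseries V) :
  ps_scale f (ps_scale g s) = ps_scale (ps_scale f (g : pseries R^o)) s.
Proof.
apply/pseriesP => n /=.
transitivity (\sum_(i < n.+1) \sum_(k < n.+1 | (i <= k)%N)
   (pcoef f i * pcoef g (k - i)%N) *: pcoef s (n - k)%N).
  apply: eq_bigr => i _; rewrite scaler_sumr.
  have le_in : (i <= n)%N by rewrite -ltnS.
  pose F k := (pcoef f i * pcoef g (k - i)%N) *: pcoef s (n - k)%N.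
  rewrite -/(F _) (sum_shift F le_in) /F.
  apply: eq_bigr => j _; rewrite scalerA addnK.
  by congr (_ *: pcoef s _); rewrite addnC subnDA.
rewrite (exchange_big_dep xpredT) //=; apply: eq_bigr => k _.
rewrite scaler_suml.
rewrite (big_ord_widen n.+1 (fun i =>
  (pcoef f i *: (pcoef g (k - i)%N : R^o)) *: pcoef s (n - k)%N)) //.
Qed.
End PseriesScaleA.

Section PseriesRing.
Variable R : comNzRingType.
Implicit Types f g : pseries R.

Definition ps_mul f g : pseries R := ps_scale f (g : pseries R^o).

Lemma pcoef_ps_mul f g n :
  pcoef (ps_mul f g) n = \sum_(i < n.+1) pcoef f i * pcoef g (n - i)%N.
Proof. by []. Qed.

Fact ps_mulA : associative ps_mul.
Proof. exact: (@ps_scaleA R R^o). Qed.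
Fact ps_mulC : commutative ps_mul.
Proof.
move=> f g; apply/pseriesP => n; rewrite !pcoef_ps_mul.
rewrite (reindex_inj rev_ord_inj) /=; apply: eq_bigr => i _.
by rewrite mulrC subSS subKn // -ltnS.
Qed.
Fact ps_mul1 : left_id (ps_const 1) ps_mul.
Proof. by move=> f; apply/pseriesP=> n; rewrite ps_scale_const scale1r. Qed.
Fact ps_mulDl : left_distributive ps_mul +%R.
Proof. by move=> f g h; rewrite /ps_mul ps_scaleDl. Qed.
Fact ps_oner_neq0 : ps_const (1 : R) != 0.
Proof.
by apply/eqP => /pseriesP/(_ 0%N)/= /eqP; rewrite oner_eq0.
Qed.

HB.instance Definition _ := GRing.Zmodule_isComNzRing.Build (pseries R)
  ps_mulA ps_mulC ps_mul1 ps_mulDl ps_oner_neq0.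

Lemma pcoefM f g n :
  pcoef (f * g) n = \sum_(i < n.+1) pcoef f i * pcoef g (n - i)%N.
Proof. by []. Qed.
End PseriesRing.

Section PseriesLmod.
Variables (R : comNzRingType) (V : lmodType R).
Implicit Types (f g : pseries R) (s t : pseries V).

Fact ps_scalerA f g s : ps_scale f (ps_scale g s) = ps_scale (f * g) s.
Proof. exact: ps_scaleA. Qed.
Fact ps_scale1 : left_id (1 : pseries R) (@ps_scale R V).
Proof. by move=> s; apply/pseriesP => n; rewrite ps_scale_const scale1r. Qed.

HB.instance Definition _ := GRing.Zmodule_isLmodule.Build (pseries R) (pseries V)
  ps_scalerA ps_scale1 (@ps_scaleDr R V) (@ps_scaleDl R V).

Lemma pcoefZ f s n :
  pcoef (f *: s) n = \sum_(i < n.+1) pcoef f i *: pcoef s (n - i)%N.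
Proof. by []. Qed.
Lemma pcoefCZ c s n : pcoef (ps_const c *: s) n = c *: pcoef s n.
Proof. exact: ps_scale_const. Qed.

Lemma ps_thetaZ f s :
  ps_theta (f *: s) = ps_theta f *: s + f *: ps_theta s.
Proof.
apply/pseriesP => n; rewrite pcoefD !pcoefZ /= -sumrMnl -big_split /=.
apply: eq_bigr => i _.
by rewrite -scalerMnl -scalerMnr -mulrnDr subnKC // -ltnS.
Qed.
End PseriesLmod.

Definition psX (R : comNzRingType) : pseries R :=
  Pseries (fun n => (n == 1%N)%:R).

Section InvertX.
Variable R : comNzRingType.
Local Notation x := (psX R).

Section Quotient.
Variable M : lmodType (pseries R).

(* (m, k) stands for m / x^k *)
Definition xloc_rel (u v : M * nat) : bool :=
  `[< exists n, x ^+ (n + v.2) *: u.1 = x ^+ (n + u.2) *: v.1 >].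

Fact xloc_rel_refl : reflexive xloc_rel.
Proof. by move=> u; apply/asboolP; exists 0%N. Qed.

Fact xloc_rel_sym : symmetric xloc_rel.
Proof. by move=> u v; apply/asboolP/asboolP => -[n e]; exists n. Qed.

Fact xloc_rel_trans : transitive xloc_rel.
Proof.
move=> [v b] [u a] [w c] /asboolP[/= n e] /asboolP[/= l e'].
apply/asboolP; exists (n + l + b)%N => /=.
have -> : (n + l + b + c = (l + c) + (n + b))%N by rewrite -!addnA; lia.
rewrite exprD -scalerA e scalerA mulrC -scalerA e' scalerA -exprD.
by congr (x ^+ _ *: w); lia.
Qed.

Definition xloc_equiv : equiv_rel (M * nat)%type :=
  EquivRel xloc_rel xloc_rel_refl xloc_rel_sym xloc_rel_trans.

(* the localization M[1/x] *)
Definition xloc := {eq_quot xloc_equiv}.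
HB.instance Definition _ := Choice.on xloc.
HB.instance Definition _ := EqQuotient.on xloc.

Definition xfrac (m : M) (k : nat) : xloc := \pi_xloc (m, k).

Lemma xfracE m k m' k' :
  xfrac m k = xfrac m' k' <->
  exists n, x ^+ (n + k') *: m = x ^+ (n + k) *: m'.
Proof.
rewrite /xfrac; split=> [/eqmodP/asboolP//|e].
by apply/eqmodP/asboolP.
Qed.

Lemma xfrac_cancel n m k : xfrac (x ^+ n *: m) (n + k) = xfrac m k.
Proof. by apply/xfracE; exists 0%N; rewrite scalerA -exprD addnC. Qed.

Lemma xfrac_eq m k m' k' :
  x ^+ k' *: m = x ^+ k *: m' -> xfrac m k = xfrac m' k'.
Proof. by move=> e; apply/xfracE; exists 0%N. Qed.

Variant xloc_spec : xloc -> Type := XlocSpec m k : xloc_spec (xfrac m k).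

Lemma xlocP u : xloc_spec u.
Proof.
suff -> : u = xfrac (repr u).1 (repr u).2 by [].
by rewrite /xfrac -surjective_pairing reprK.
Qed.

Definition xloc_zero : xloc := xfrac 0 0.
Definition xloc_opp (u : xloc) : xloc := xfrac (- (repr u).1) (repr u).2.
Definition xloc_add (u v : xloc) : xloc :=
  xfrac (x ^+ (repr v).2 *: (repr u).1 + x ^+ (repr u).2 *: (repr v).1)
    ((repr u).2 + (repr v).2).

Lemma xfrac_repr m k :
  exists n, x ^+ (n + k) *: (repr (xfrac m k)).1
            = x ^+ (n + (repr (xfrac m k)).2) *: m.
Proof.
by apply/xfracE; rewrite [LHS]/xfrac -surjective_pairing reprK.
Qed.

Lemma xloc_oppE m k : xloc_opp (xfrac m k) = xfrac (- m) k.
Proof.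
apply/xfracE; have [n e] := xfrac_repr m k; exists n.
by rewrite !scalerN e.
Qed.

Lemma xloc_addE m k m' k' :
  xloc_add (xfrac m k) (xfrac m' k')
  = xfrac (x ^+ k' *: m + x ^+ k *: m') (k + k').
Proof.
apply/xfracE.
case: (xfrac_repr m k) (xfrac_repr m' k') => [n e] [n' e'].
move: (repr _) (repr _) e e' => [b j] [a i] /= e e'.
exists (n + n')%N; rewrite !scalerDr !scalerA -!exprD; congr (_ + _).
  have -> : (n + n' + (k + k') + j = (n' + k' + j) + (n + k))%N by lia.
  by rewrite exprD -scalerA e scalerA -exprD; congr (x ^+ _ *: _); lia.
have -> : (n + n' + (k + k') + i = (n + k + i) + (n' + k'))%N by lia.
by rewrite exprD -scalerA e' scalerA -exprD; congr (x ^+ _ *: _); lia.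
Qed.

Fact xloc_addC : commutative xloc_add.
Proof.
by move=> u v; case: (xlocP u) (xlocP v) => m k [m' k'];
  rewrite !xloc_addE addrC addnC.
Qed.

Fact xloc_addA : associative xloc_add.
Proof.
move=> u v w; case: (xlocP u) (xlocP v) (xlocP w) => m k [m' k'] [m'' k''].
rewrite !xloc_addE addnA; congr xfrac.
rewrite !scalerDr !scalerA -!exprD addrA; congr (_ *: _ + _ *: _ + _ *: _);
  by congr (_ ^+ _); lia.
Qed.

Fact xloc_add0 : left_id xloc_zero xloc_add.
Proof.
by move=> u; case: (xlocP u) => m k; rewrite xloc_addE scaler0 add0r scale1r.
Qed.

Fact xloc_addN : left_inverse xloc_zero xloc_opp xloc_add.
Proof.
move=> u; case: (xlocP u) => m k; rewrite xloc_oppE xloc_addE scalerN addNr.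
by apply: xfrac_eq; rewrite !scaler0.
Qed.

HB.instance Definition _ := GRing.isZmodule.Build xloc
  xloc_addA xloc_addC xloc_add0 xloc_addN.

Lemma xfracD m k m' k' :
  xfrac m k + xfrac m' k' = xfrac (x ^+ k' *: m + x ^+ k *: m') (k + k').
Proof. exact: xloc_addE. Qed.

Lemma xfracN m k : - xfrac m k = xfrac (- m) k.
Proof. exact: xloc_oppE. Qed.

Lemma xfrac0 k : xfrac 0 k = 0.
Proof. by apply: xfrac_eq; rewrite !scaler0. Qed.

Lemma xfracDk m m' k : xfrac m k + xfrac m' k = xfrac (m + m') k.
Proof. by rewrite xfracD -scalerDr xfrac_cancel. Qed.
End Quotient.

Section Action.
Variable M : lmodType (pseries R).

(* (f / x^k) (m / x^l) = f m / x^(k + l); for M = C[[x]] this is the product *)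
Definition xloc_scale (f : xloc (pseries R)^o) (u : xloc M) : xloc M :=
  xfrac ((repr f).1 *: (repr u).1) ((repr f).2 + (repr u).2).

Lemma xloc_scaleE (f : pseries R) k (m : M) l :
  xloc_scale (xfrac (f : (pseries R)^o) k) (xfrac m l) = xfrac (f *: m) (k + l).
Proof.
apply/xfracE.
case: (xfrac_repr (f : (pseries R)^o) k) (xfrac_repr m l) => [n e] [n' e'].
move: (repr _) (repr _) e e' => [b j] [g i] /= e e'.
exists (n + n')%N.
have -> : (n + n' + (k + l) = (n + k) + (n' + l))%N by lia.
rewrite exprD -!scalerA [_ *: (g *: b)]scalerA [_ * g]mulrC -[_ *: b]scalerA e'.
rewrite !scalerA [_ * g]e; congr (_ *: m).
by rewrite ![(_ : (pseries R)^o) *: _]/GRing.scale /= mulrAC -exprD; congr (x ^+ _ * _); lia.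
Qed.
End Action.
End InvertX.

(* C((x)) = C[[x]][1/x]; it is identified with the sequences (a_i) indexed by  *)
(* the integers and zero for i << 0 in [lcoefP] and [lcoef_surj] below.        *)
Definition laurent (C : fieldType) : Type := xloc (pseries C)^o.

Section Laurent.
Variable C : fieldType.
Local Notation x := (psX C).
Local Notation L := (laurent C).

HB.instance Definition _ := GRing.Zmodule.on L.

Definition lfrac (f : pseries C) (k : nat) : L := xfrac (f : (pseries C)^o) k.

Variant laurent_spec : L -> Type := LaurentSpec f k : laurent_spec (lfrac f k).

Lemma laurentP (u : L) : laurent_spec u.
Proof. by case: (xlocP u) => f k. Qed.

Lemma lfracD f k g l : lfrac f k + lfrac g l = lfrac (x ^+ l * f + x ^+ k * g) (k + l).
Proof. exact: xfracD. Qed.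

Section Scale.
Variable M : lmodType (pseries C).

Lemma lscaleE f k (m : M) l :
  xloc_scale (lfrac f k) (xfrac m l) = xfrac (f *: m) (k + l).
Proof. exact: xloc_scaleE. Qed.

Fact lscaleDr (f : L) (u v : xloc M) :
  xloc_scale f (u + v) = xloc_scale f u + xloc_scale f v.
Proof.
case: (laurentP f) (xlocP u) (xlocP v) => {}f k [m l] [m' l'].
rewrite xfracD !lscaleE xfracD scalerDr !scalerA; apply: xfrac_eq.
rewrite !scalerDr !scalerA; congr (_ *: _ + _ *: _).
  by rewrite mulrCA [LHS]mulrC [RHS]mulrA -!exprD; congr (_ ^+ _ * _); lia.
by rewrite mulrCA [LHS]mulrC [RHS]mulrA -!exprD; congr (_ ^+ _ * _); lia.
Qed.

Fact lscaleDl (u : xloc M) (f g : L) :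
  xloc_scale (f + g) u = xloc_scale f u + xloc_scale g u.
Proof.
case: (laurentP f) (laurentP g) (xlocP u) => {}f k [{}g l] [m n].
rewrite lfracD !lscaleE xfracD !scalerA; apply: xfrac_eq.
rewrite -!scalerDl !scalerA; congr (_ *: _).
rewrite !mulrDr !mulrA -!exprD; congr (_ ^+ _ * _ + _ ^+ _ * _); lia.
Qed.
End Scale.

Definition lmul (f g : L) : L := xloc_scale f g.
Definition lone : L := lfrac 1 0.

Lemma lmulE f k g l : lmul (lfrac f k) (lfrac g l) = lfrac (f * g) (k + l).
Proof. exact: lscaleE. Qed.

Lemma lscaleA (M : lmodType (pseries C)) (f g : L) (u : xloc M) :
  xloc_scale f (xloc_scale g u) = xloc_scale (lmul f g) u.
Proof.
case: (laurentP f) (laurentP g) (xlocP u) => {}f k [{}g l] [m n].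
by rewrite lmulE !lscaleE scalerA addnA.
Qed.

Lemma lscale1 (M : lmodType (pseries C)) : left_id lone (@xloc_scale C M).
Proof. by move=> u; case: (xlocP u) => m k; rewrite lscaleE scale1r. Qed.

Fact lmulA : associative lmul.
Proof. by move=> f g h; rewrite /lmul lscaleA. Qed.
Fact lmulC : commutative lmul.
Proof.
move=> f g; case: (laurentP f) (laurentP g) => {}f k [{}g l].
by rewrite !lmulE mulrC addnC.
Qed.
Fact lmul1 : left_id lone lmul.
Proof. exact: lscale1. Qed.
Fact lmulDl : left_distributive lmul +%R.
Proof. move=> f g h; exact: lscaleDl. Qed.

Lemma pcoefXM (f : pseries C) n k :
  pcoef (x ^+ n * f) k = if (k < n)%N then 0 else pcoef f (k - n)%N.
Proof.
elim: n k => [|n IHn] k; first by rewrite mul1r subn0.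
rewrite exprS -mulrA; move: (_ * f) IHn => h IHn; rewrite pcoefM.
case: k => [|k]; first by rewrite big_ord_recl big_ord0 mul0r addr0.
rewrite !big_ord_recl /= mul0r mul1r add0r big1 ?addr0 => [|i _].
  by rewrite subn1 IHn.
by rewrite mul0r.
Qed.

Lemma psXn_inj n (f g : pseries C) : x ^+ n * f = x ^+ n * g -> f = g.
Proof.
move=> e; apply/pseriesP => k; move/pseriesP/(_ (n + k)%N): e.
by rewrite !pcoefXM ltnNge leq_addr addKn.
Qed.

Lemma lfracE f k g l : lfrac f k = lfrac g l <-> x ^+ l * f = x ^+ k * g.
Proof.
split=> [/xfracE[n]|e]; last exact: xfrac_eq.
rewrite ![_ *: _]/GRing.scale /= ![x ^+ (n + _)]exprD -!mulrA.
exact: psXn_inj.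
Qed.

Fact loner_neq0 : lone != 0.
Proof.
apply/eqP => /lfracE /pseriesP /(_ 0%N) /eqP.
by rewrite !expr0 mulr1 mulr0 oner_eq0.
Qed.

HB.instance Definition _ := GRing.Zmodule_isComNzRing.Build L
  lmulA lmulC lmul1 lmulDl loner_neq0.

Lemma lfracM f k g l : lfrac f k * lfrac g l = lfrac (f * g) (k + l).
Proof. exact: lmulE. Qed.

(* The first n coefficients of the inverse of f. *)
Fixpoint ps_inv_seq (f : pseries C) (n : nat) : seq C :=
  if n is n'.+1 then
    let s := ps_inv_seq f n' in
    rcons s ((pcoef f 0)^-1 *
             ((n' == 0%N)%:R - \sum_(i < n') pcoef f i.+1 * nth 0 s (n' - i.+1)))
  else [::].

Lemma ps_unit (f : pseries C) : pcoef f 0 != 0 -> exists g, g * f = 1.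
Proof.
move=> f0; pose g := Pseries (fun n => nth 0 (ps_inv_seq f n.+1) n).
have sz n : size (ps_inv_seq f n) = n by elim: n => //= n IHn; rewrite size_rcons IHn.
have nthg n m : (m < n)%N -> nth 0 (ps_inv_seq f n) m = pcoef g m.
  elim: n => // n IHn; rewrite ltnS leq_eqVlt => /orP[/eqP->//|lt_mn].
  by rewrite /= nth_rcons sz lt_mn IHn.
exists g; rewrite mulrC; apply/pseriesP => n.
rewrite pcoefM big_ord_recl subn0 {1}/g /= nth_rcons sz ltnn eqxx mulVKf //.
rewrite [X in _ - X + _](eq_bigr (fun i : 'I_n => pcoef f i.+1 * pcoef g (n - i.+1)%N)).
  by rewrite subrK; case: (n).
by move=> i _; rewrite nthg //; have := ltn_ord i; lia.
Qed.

Lemma laurent_unit (u : L) : u != 0 -> exists v, v * u = 1.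
Proof.
case: (laurentP u) => f k u0.
have [n fn] : exists n, pcoef f n != 0.
  apply/not_existsP => fP; case/eqP: u0; apply/lfracE.
  rewrite mul1r mulr0; apply/pseriesP => n; apply/eqP.
  by apply/negP => /negP; apply: fP.
case: (ex_minnP (ex_intro (fun n => pcoef f n != 0) n fn)) => {fn}v fv vmin.
pose g := Pseries (fun i => pcoef f (i + v)%N).
have ef : f = x ^+ v * g.
  apply/pseriesP => i; rewrite pcoefXM; case: ltnP => [lt_iv|le_vi].
    by apply/eqP; apply: contraTT lt_iv => /vmin; rewrite -leqNgt.
  by rewrite /= subnK.
have [h hg] := ps_unit (fv : pcoef g 0 != 0).
exists (lfrac (x ^+ k * h) v); rewrite lfracM; apply/lfracE.
by rewrite mul1r mulr1 ef mulrACA -exprD hg mulr1 addnC.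
Qed.

Definition linv (u : L) : L :=
  if pselect (exists v, v * u = 1) is left uV then projT1 (cid uV) else 0.

Fact lmulVf (u : L) : u != 0 -> linv u * u = 1.
Proof.
move=> u0; rewrite /linv; case: pselect => [uV|[]]; last exact: laurent_unit.
by case: cid.
Qed.

Fact linv0 : linv 0 = 0.
Proof.
rewrite /linv; case: pselect => // uV.
by have [v /eqP] : exists v : L, v * 0 = 1 := uV; rewrite mulr0 eq_sym oner_eq0.
Qed.

HB.instance Definition _ := GRing.ComNzRing_isField.Build L lmulVf linv0.

Definition lconst (c : C) : L := lfrac (ps_const c) 0.

Lemma lconst_scale (M : lmodType (pseries C)) c (m : M) k :
  xloc_scale (lconst c) (xfrac m k) = xfrac (ps_const c *: m) k.
Proof. exact: lscaleE. Qed.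
End Laurent.

Section LaurentLmod.
Variables (C : fieldType) (M : lmodType (pseries C)).

Fact lscalerA (f g : laurent C) (u : xloc M) :
  xloc_scale f (xloc_scale g u) = xloc_scale (f * g) u.
Proof. exact: lscaleA. Qed.

HB.instance Definition _ := GRing.Zmodule_isLmodule.Build (laurent C) (xloc M)
  lscalerA (@lscale1 C M) (@lscaleDr C M) (@lscaleDl C M).

Lemma lfracZ f k (m : M) l : lfrac f k *: xfrac m l = xfrac (f *: m) (k + l).
Proof. exact: lscaleE. Qed.

Lemma lconstZ c (m : M) k : lconst c *: xfrac m k = xfrac (ps_const c *: m) k.
Proof. exact: lconst_scale. Qed.
End LaurentLmod.

Section LaurentCoef.
Variable C : fieldType.

(* the coefficient of x^i *)
Definition lcoef (u : laurent C) (i : int) : C :=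
  if i + (repr u).2%:Z is Posz n then pcoef (repr u).1 n else 0.

Lemma coef_shift (f : pseries C) k (i : int) :
  (if i + k%:Z is Posz n then pcoef (psX C ^+ k * f) n else 0) =
  (if i is Posz n then pcoef f n else 0).
Proof.
case: i => n; first by rewrite -PoszD pcoefXM ltnNge leq_addl addnK.
case e: (Negz n + k%:Z) => [m|//]; rewrite pcoefXM ifT //.
by move: e; rewrite NegzE; lia.
Qed.

Lemma lcoef_lfrac (f : pseries C) k i :
  lcoef (lfrac f k) i = if i + k%:Z is Posz n then pcoef f n else 0.
Proof.
rewrite /lcoef; have : lfrac (repr (lfrac f k)).1 (repr (lfrac f k)).2 = lfrac f k.
  by rewrite /lfrac {1}/xfrac -surjective_pairing reprK.
move: (repr _) => [g l] /= /lfracE e.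
by rewrite -(coef_shift g k) e addrAC coef_shift.
Qed.

Lemma lcoefP (u v : laurent C) : lcoef u =1 lcoef v <-> u = v.
Proof.
split=> [|-> //]; case: (laurentP u) (laurentP v) => f k [g l] e.
apply/lfracE/pseriesP => n.
have := e (n%:Z - (k + l)%N%:Z); rewrite !lcoef_lfrac.
rewrite -(coef_shift f l) -(coef_shift g k).
have -> : n%:Z - (k + l)%N%:Z + k%:Z + l%:Z = n%:Z by lia.
by have -> : n%:Z - (k + l)%N%:Z + l%:Z + k%:Z = n%:Z by lia.
Qed.

Lemma lcoef_surj (a : int -> C) :
  (exists k : nat, forall i : int, (i < - k%:Z)%R -> a i = 0) <->
  (exists u : laurent C, lcoef u =1 a).
Proof.
split=> [[k ak]|[u uE]].
  exists (lfrac (Pseries (fun n => a (n%:Z - k%:Z))) k) => i.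
  rewrite lcoef_lfrac; case e: (i + k%:Z) => [n|n] /=.
    by congr a; rewrite -e addrK.
  by rewrite ak //; move: e; rewrite NegzE; lia.
case: (laurentP u) uE => f k uE; exists k => i ik; rewrite -uE lcoef_lfrac.
by case e: (i + k%:Z) => [n|//]; move: e; lia.
Qed.

Lemma lcoefD (u v : laurent C) i : lcoef (u + v) i = lcoef u i + lcoef v i.
Proof.
case: (laurentP u) (laurentP v) => f k [g l].
rewrite lfracD !lcoef_lfrac -(coef_shift f l) -(coef_shift g k).
rewrite [i + l%:Z + _]addrAC PoszD addrA.
by case: (i + _ + _) => [n|n]; rewrite ?addr0.
Qed.
End LaurentCoef.

Section XlocNabla.
Variables (C : fieldType) (M : lmodType (pseries C)).
Local Notation x := (psX C).

(* nabla (m / x^k) = (nabla m - k m) / x^k *)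
Definition xloc_nabla (nabla : M -> M) (u : xloc M) : xloc M :=
  xfrac (nabla (repr u).1 - (repr u).1 *+ (repr u).2) (repr u).2.

Lemma ps_thetaXn n : ps_theta (x ^+ n) = x ^+ n *+ n.
Proof.
apply/pseriesP => k.
have -> : pcoef (x ^+ n *+ n) k = pcoef (x ^+ n) k *+ n.
  by elim: {2 4}n => // m IHm; rewrite !mulrS pcoefD IHm.
rewrite [LHS]/= -[x ^+ n]mulr1 pcoefXM; case: ltnP => [_|le_nk].
  by rewrite !mul0rn.
have [->//|ne] := eqVneq n k.
have -> : pcoef (1 : pseries C) (k - n) = 0.
  by rewrite /= subn_eq0 leqNgt ltn_neqAle ne le_nk.
by rewrite !mul0rn.
Qed.

Section Extension.
Variable nabla : M -> M.
Hypothesis nabla_Clinear : forall c m m',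
  nabla (ps_const c *: m + m') = ps_const c *: nabla m + nabla m'.
Hypothesis nabla_leibniz : forall f m,
  nabla (f *: m) = ps_theta f *: m + f *: nabla m.

Lemma nablaD m m' : nabla (m + m') = nabla m + nabla m'.
Proof. by have := nabla_Clinear 1 m m'; rewrite !scale1r. Qed.

Lemma nablaXn n m : nabla (x ^+ n *: m) = x ^+ n *: (nabla m + m *+ n).
Proof.
by rewrite nabla_leibniz ps_thetaXn scalerDr addrC -scalerMnl -scalerMnr.
Qed.

Lemma nabla_shift (v w : M) p q : v - w *+ q = (v + w *+ p) - w *+ (p + q).
Proof. by rewrite mulrnDr opprD addrA addrK. Qed.

Lemma xloc_nablaE m k :
  xloc_nabla nabla (xfrac m k) = xfrac (nabla m - m *+ k) k.
Proof.
apply/xfracE; have [n] := xfrac_repr m k.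
move: (repr _) => [a i] /= e; exists n.
have := congr1 nabla e; rewrite !nablaXn => e'.
rewrite (nabla_shift _ a (n + k)) (nabla_shift _ m (n + i)).
rewrite !scalerBr e'.
by rewrite -!scalerMnr e addnAC.
Qed.

Lemma xloc_nabla_Clinear c (u v : xloc M) :
  xloc_nabla nabla (lconst c *: u + v)
  = lconst c *: xloc_nabla nabla u + xloc_nabla nabla v.
Proof.
case: (xlocP u) (xlocP v) => m k [m' k'].
have e (w w' : M) : lconst c *: xfrac w k + xfrac w' k'
  = xfrac (ps_const c *: (x ^+ k' *: w) + x ^+ k *: w') (k + k').
  by rewrite lconstZ xfracD !scalerA [_ * x ^+ _]mulrC.
rewrite e !xloc_nablaE e nabla_Clinear !nablaXn; congr xfrac.
rewrite mulrnDl opprD addrACA !scalerMnr -!scalerBr.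
by rewrite (nabla_shift (nabla m) m k' k) (nabla_shift (nabla m') m' k k') [(k' + k)%N]addnC.
Qed.
End Extension.
End XlocNabla.

Section LaurentTheta.
Variable C : fieldType.

(* x d/dx *)
Definition ltheta : laurent C -> laurent C :=
  xloc_nabla (M := (pseries C)^o) (@ps_theta C).

Lemma ps_theta_Clinear (V : lmodType C) c (s t : pseries V) :
  ps_theta (ps_const c *: s + t) = ps_const c *: ps_theta s + ps_theta t.
Proof.
apply/pseriesP => n.
by rewrite pcoefD pcoefCZ !pcoef_theta pcoefD pcoefCZ mulrnDl scalerMnr.
Qed.

Lemma lthetaE f k : ltheta (lfrac f k) = lfrac (ps_theta f - f *+ k) k.
Proof.
apply: (@xloc_nablaE C (pseries C)^o) => g h.
exact: (@ps_thetaZ C C^o).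
Qed.

Lemma lcoef_ltheta u i : lcoef (ltheta u) i = lcoef u i *~ i.
Proof.
case: (laurentP u) => f k; rewrite lthetaE !lcoef_lfrac.
case e: (i + k%:Z) => [n|n]; last by rewrite mul0rz.
have -> : i = n%:Z - k%:Z by rewrite -e addrK.
have pcN (g : pseries C) : pcoef (- g) n = - pcoef g n by [].
have pcM (g : pseries C) m : pcoef (g *+ m) n = pcoef g n *+ m.
  by elim: m => // m IHm; rewrite !mulrS pcoefD IHm.
by rewrite pcoefD pcN pcM mulrzBr.
Qed.

Lemma xloc_nabla_leibniz (M : lmodType (pseries C)) (nabla : M -> M)
    (nabla_leibniz : forall f m,
       nabla (f *: m) = ps_theta f *: m + f *: nabla m)
    (f : laurent C) (u : xloc M) :
  xloc_nabla nabla (f *: u) = ltheta f *: u + f *: xloc_nabla nabla u.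
Proof.
case: (laurentP f) (xlocP u) => {}f k [m l].
rewrite lthetaE lfracZ !xloc_nablaE // !lfracZ xfracDk nabla_leibniz.
congr xfrac; rewrite scalerBl scalerBr addrACA -opprD; congr (_ - _).
by rewrite mulrnDr scalerMnl scalerMnr.
Qed.
End LaurentTheta.

Section LogCategory.
Variable C : fieldType.

Definition MClog : category := MC (@ps_const C) (@ps_theta C).
Definition MClaurent : category := MC (@lconst C) (@ltheta C).

Section GammaObj.
Variable M : MClog.

Fact gamma_fin : finitely_generated (xloc M : lmodType (laurent C)).
Proof.
have [n [e eP]] := mc_fin M; exists n, (fun i => xfrac (e i) 0) => u.
case: (xlocP u) => m k; have [a ->] := eP m; exists (fun i => lfrac (a i) k).
have xs (r : seq 'I_n) (F : 'I_n -> M) :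
    xfrac (\sum_(i <- r) F i) k = \sum_(i <- r) xfrac (F i) k.
  elim: r => [|i r IHr]; first by rewrite !big_nil xfrac0.
  by rewrite !big_cons -xfracDk IHr.
by rewrite xs; apply: eq_bigr => i _; rewrite lfracZ addn0.
Qed.

Definition gamma_obj : MClaurent :=
  MCObj gamma_fin
    (xloc_nabla_Clinear (@mc_Clinear _ _ _ _ M) (@mc_leibniz _ _ _ _ M))
    (xloc_nabla_leibniz (@mc_leibniz _ _ _ _ M)).
End GammaObj.

Section GammaHom.
Variables (M N : MClog) (f : hom M N).

(* m / x^k |-> f m / x^k *)
Definition gamma_fun (u : gamma_obj M) : gamma_obj N :=
  xfrac (mc_fun f (repr u).1) (repr u).2.

Lemma gamma_funE m k : gamma_fun (xfrac m k) = xfrac (mc_fun f m) k.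
Proof.
apply/xfracE; have [n] := xfrac_repr m k.
move: (repr _) => [a i] /= e; exists n.
by rewrite -!mc_funZ e.
Qed.

Lemma gamma_fun_linear : linear gamma_fun.
Proof.
move=> c u v; case: (laurentP c) (xlocP u) (xlocP v) => g j [m k] [m' l].
rewrite lfracZ xfracD !gamma_funE lfracZ xfracD; congr xfrac.
by rewrite -[in RHS]mc_funZ -[_ *: mc_fun f m']mc_funZ mc_fun_linear.
Qed.

Lemma gamma_fun_nabla u : gamma_fun (mc_nabla u) = mc_nabla (gamma_fun u).
Proof.
case: (xlocP u) => m k.
rewrite gamma_funE /= !xloc_nablaE ?gamma_funE; try exact: mc_Clinear;
  try exact: mc_leibniz.
by rewrite -mc_fun_nabla mc_funB mc_funMn.
Qed.

Definition gamma_hom : hom (gamma_obj M) (gamma_obj N) :=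
  MCHom gamma_fun_linear gamma_fun_nabla.
End GammaHom.

Definition gamma : functor MClog MClaurent.
Proof.
refine (@Functor MClog MClaurent gamma_obj gamma_hom _ _).
- by move=> M; apply: mc_hom_eq => u; case: (xlocP u) => m k; exact: gamma_funE.
- move=> M N P g f; apply: mc_hom_eq => u; case: (xlocP u) => m k.
  by rewrite /= !gamma_funE.
Defined.

Definition regular_singular (M : MClaurent) : Prop :=
  exists L : MClog, isomorphic M (gamma L).

Definition MCrs : category := full_subcategory regular_singular.

Fact gamma_rs (L : MClog) : regular_singular (gamma L).
Proof.
by exists L, (idm (gamma L)), (idm (gamma L)); rewrite comp_idl.
Qed.

Definition gammars : functor MClog MCrs := functor_corestrict gamma_rs.

Fact regular_fin (R : comNzRingType) : finitely_generated (R^o : lmodType R).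
Proof.
exists 1%N, (fun=> 1) => f; exists (fun=> f).
by rewrite big_ord_recl big_ord0 addr0 [_ *: _]mulr1.
Qed.

Fact ltheta_Clinear c (f g : (laurent C)^o) :
  ltheta (lconst c *: f + g) = lconst c *: ltheta f + ltheta g.
Proof.
apply: (@xloc_nabla_Clinear C (pseries C)^o) => [b s t|s t].
  exact: (@ps_theta_Clinear C C^o).
exact: (@ps_thetaZ C C^o).
Qed.

Fact ltheta_leibniz (f : laurent C) (g : (laurent C)^o) :
  ltheta (f *: g) = ltheta f *: g + f *: ltheta g.
Proof.
apply: (@xloc_nabla_leibniz C (pseries C)^o) => s t.
exact: (@ps_thetaZ C C^o).
Qed.

Definition laurent_unit_obj : MClaurent :=
  @MCObj C (laurent C) (@lconst C) (@ltheta C) (laurent C)^o (@ltheta C)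
    (@regular_fin (laurent C)) ltheta_Clinear ltheta_leibniz.

Definition pseries_unit_obj : MClog :=
  @MCObj C (pseries C) (@ps_const C) (@ps_theta C) (pseries C)^o (@ps_theta C)
    (@regular_fin (pseries C)) (@ps_theta_Clinear C C^o) (@ps_thetaZ C C^o).

Fact laurent_unit_rs : regular_singular laurent_unit_obj.
Proof.
exists pseries_unit_obj.
have lin : linear (fun u : (laurent C)^o => (u : xloc (pseries C)^o)) by [].
have lin' : linear (fun u : xloc (pseries C)^o => (u : (laurent C)^o)) by [].
exists (@MCHom C (laurent C) _ _ laurent_unit_obj (gamma_obj pseries_unit_obj)
          _ lin (fun=> erefl)).
exists (@MCHom C (laurent C) _ _ (gamma_obj pseries_unit_obj) laurent_unit_obj
          _ lin' (fun=> erefl)).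
by split; apply: mc_hom_eq.
Qed.

Definition MCrs_unit : MCrs := exist _ laurent_unit_obj laurent_unit_rs.

End LogCategory.

Section Eul.
Variable C : fieldType.

Section PseriesTensor.
Variable V : vectType C.

(* f (x) v *)
Definition ps_tensor (f : pseries C) (v : V) : pseries V := f *: ps_const v.

Lemma pcoef_tensor f v n : pcoef (ps_tensor f v) n = pcoef f n *: v.
Proof.
rewrite pcoefZ big_ord_recr /= subnn big1 ?add0r // => i _.
by rewrite subn_eq0 leqNgt ltn_ord /= scaler0.
Qed.

Lemma ps_tensor_basis (s : pseries V) :
  s = \sum_i ps_tensor (Pseries (fun n => coord (vbasis fullv) i (pcoef s n)))
                       (vbasis fullv)`_i.
Proof.
apply/pseriesP => n; rewrite pcoef_sum.
rewrite {1}(coord_vbasis (memvf (pcoef s n))).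
by apply: eq_bigr => i _; rewrite pcoef_tensor.
Qed.

(* The universal property of C[[x]] (x)_C V, as extension of scalars. *)
Lemma pseries_tensor_universal (W : lmodType (pseries C)) (phi : V -> W) :
  (forall c v w, phi (c *: v + w) = ps_const c *: phi v + phi w) ->
  exists! Phi : pseries V -> W,
    linear Phi /\ forall f v, Phi (ps_tensor f v) = f *: phi v.
Proof.
move=> phi_lin.
have phiD v w : phi (v + w) = phi v + phi w.
  have := phi_lin 1 v w; rewrite scale1r => ->; congr (_ + _).
  exact: scale1r.
have phi0 : phi 0 = 0 by apply: (addIr (phi 0)); rewrite -phiD !add0r.
have phiZ c v : phi (c *: v) = ps_const c *: phi v.
  by have := phi_lin c v 0; rewrite !addr0 phi0 addr0.
have phi_sum (I : Type) (r : seq I) (F : I -> V) :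
    phi (\sum_(i <- r) F i) = \sum_(i <- r) phi (F i).
  by elim: r => [|i r IHr]; rewrite ?big_nil ?phi0 // !big_cons phiD IHr.
pose e := vbasis (@fullv C V).
pose co i (s : pseries V) := Pseries (fun n => coord e i (pcoef s n)).
have coE i s n : pcoef (co i s) n = coord e i (pcoef s n) by [].
exists (fun s => \sum_i co i s *: phi e`_i); split.
  split=> [f s t|f v].
    rewrite scaler_sumr -big_split; apply: eq_bigr => i _ /=.
    rewrite scalerA -scalerDl; congr (_ *: _).
    apply/pseriesP => n; rewrite coE !pcoefD pcoefM pcoefZ coE linearD linear_sum.
    by congr (_ + _); apply: eq_bigr => j _; rewrite coE linearZ.
  rewrite {2}(coord_vbasis (memvf v)) phi_sum scaler_sumr; apply: eq_bigr => i _.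
  rewrite phiZ scalerA [f * _]mulrC; congr (_ *: _); apply/pseriesP => n.
  by rewrite coE pcoef_tensor linearZ [RHS](@pcoefCZ C C^o); apply: mulrC.
move=> Phi [Phi_lin PhiE]; apply/funext => s.
have PhiD u v : Phi (u + v) = Phi u + Phi v.
  by have := Phi_lin 1 u v; rewrite !scale1r.
have Phi0 : Phi 0 = 0 by apply: (addIr (Phi 0)); rewrite -PhiD !add0r.
rewrite {2}(ps_tensor_basis s).
rewrite (big_morph Phi PhiD Phi0); apply: eq_bigr => i _.
by rewrite PhiE.
Qed.
End PseriesTensor.

Section EulObj.
Variable V : EndCat C.

(* D_A = theta (x) id + id (x) A *)
Definition eul_nabla (s : pseries V) : pseries V :=
  Pseries (fun n => pcoef s n *+ n + end_map V (pcoef s n)).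

Lemma pcoef_eul s n :
  pcoef (eul_nabla s) n = pcoef s n *+ n + end_map V (pcoef s n).
Proof. by []. Qed.

Lemma eul_nabla_tensor f v :
  eul_nabla (ps_tensor f v)
  = ps_tensor (ps_theta f) v + ps_tensor f (end_map V v).
Proof.
apply/pseriesP => n; rewrite pcoefD pcoef_eul !pcoef_tensor pcoef_theta.
by rewrite linearZ scalerMnl.
Qed.

Fact eul_fin : finitely_generated (pseries V : lmodType (pseries C)).
Proof.
exists (\dim (@fullv C V)), (fun i => ps_const (vbasis fullv)`_i) => s.
by exists (fun i => Pseries (fun n => coord (vbasis fullv) i (pcoef s n)));
  apply: ps_tensor_basis.
Qed.

Fact eul_Clinear c (s t : pseries V) :
  eul_nabla (ps_const c *: s + t) = ps_const c *: eul_nabla s + eul_nabla t.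
Proof.
apply/pseriesP => n.
rewrite pcoefD pcoefCZ !pcoef_eul pcoefD pcoefCZ linearP mulrnDl scalerMnr.
by rewrite addrACA scalerDr.
Qed.

Fact eul_leibniz f (s : pseries V) :
  eul_nabla (f *: s) = ps_theta f *: s + f *: eul_nabla s.
Proof.
apply/pseriesP => n; have /pseriesP/(_ n) := ps_thetaZ f s.
rewrite pcoef_theta pcoef_eul !pcoefD => ->; rewrite -addrA; congr (_ + _).
rewrite !pcoefZ linear_sum -big_split; apply: eq_bigr => i _ /=.
by rewrite linearZ -scalerDr.
Qed.

Definition eul_obj : MClog C := MCObj eul_fin eul_Clinear eul_leibniz.
End EulObj.

Section EulHom.
Variables (V W : EndCat C) (phi : hom V W).

(* id (x) phi *)
Definition eul_fun (s : eul_obj V) : eul_obj W :=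
  Pseries (fun n => end_fun phi (pcoef s n)).

Lemma pcoef_eul_fun s n : pcoef (eul_fun s) n = end_fun phi (pcoef s n).
Proof. by []. Qed.

Lemma eul_fun_tensor f (v : V) :
  eul_fun (ps_tensor f v) = ps_tensor f (end_fun phi v).
Proof.
by apply/pseriesP => n; rewrite pcoef_eul_fun !pcoef_tensor linearZ.
Qed.

Fact eul_fun_linear : linear eul_fun.
Proof.
move=> f s t; apply/pseriesP => n.
rewrite pcoefD pcoefZ !pcoef_eul_fun pcoefD pcoefZ linearD linear_sum.
by congr (_ + _); apply: eq_bigr => i _; rewrite linearZ.
Qed.

Fact eul_fun_nabla s : eul_fun (mc_nabla s) = mc_nabla (eul_fun s).
Proof.
apply/pseriesP => n; rewrite pcoef_eul_fun /= linearD linearMn; congr (_ + _).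
by have /lfunP/(_ (pcoef s n)) := end_funP phi; rewrite !comp_lfunE.
Qed.

Definition eul_hom : hom (eul_obj V) (eul_obj W) :=
  MCHom eul_fun_linear eul_fun_nabla.
End EulHom.

Definition eul : functor (EndCat C) (MClog C).
Proof.
refine (@Functor (EndCat C) (MClog C) eul_obj eul_hom _ _).
- move=> V; apply: mc_hom_eq => s; apply/pseriesP => n /=.
  by rewrite id_lfunE.
- move=> U V W g f; apply: mc_hom_eq => s; apply/pseriesP => n /=.
  by rewrite comp_lfunE.
Defined.

Definition gamma_eul : functor (EndCat C) (MCrs C) :=
  functor_comp (gammars C) eul.

Definition End_unipotent : EndCat C -> Prop := unipotent (end_unit C).
Definition MCrs_unipotent : MCrs C -> Prop := unipotent (MCrs_unit C).
End Eul.

(* Main.v *)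
From HB Require Import structures.
From mathcomp Require Import all_boot all_order all_algebra.
From mathcomp Require Import boolp.
Require Import Defs.

(** Call a basis u_0, ..., u_(n-1) of an object triangular when the connection
    maps each u_j to a combination, with coefficients in C, of the u_i with
    i < j. On both sides of the functor, an object is unipotent exactly when
    it has a triangular basis ([End_unipotentP], [MCrs_unipotentP]).

    From triangular bases to filtrations, one takes the spans of the initial
    segments, up to isomorphism ([tri_unipotent]). In the other direction ([unipotent_tri]) one
    goes up the filtration: if E extends the unit object by N, and m in E lifts
    the generator of the unit object, then nabla m lies in N, and replacing m
    by m - v with v in N makes nabla m a C-combination of the basis of N. Such
    a v exists because, in characteristic zero, every Laurent series is a
    constant plus some theta h ([laurent_primitive]) and because this passes to N by induction along its basis ([tri_solve]).

    The two categories are handled at once. An object (V, A) of End is a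
    connection over the field C itself with the zero derivation, so both
    categories are full subcategories of connections over a field K with
    constants C, where K is C or C((x)). The common argument needs that every
    g in K is a constant plus some theta h, that every arrow has a concrete
    quotient by its image (for regular singular connections, the quotient of a
    lattice by the trace of the image, [lattice_proj_kernel]), and that every
    triangular matrix occurs.

    Since gamma eul sends a triangular basis of V to a triangular basis of the
    same matrix ([geul_tri_basis]), it preserves unipotent objects, and it is
    essentially surjective because two objects with bases of the same matrix
    are isomorphic ([tri_isomorphic]). It is fully faithful because V can be
    recovered inside C((x)) (x) V as the space of vectors killed by a power of
    nabla: on x^i V the connection acts as A + i, which for A nilpotent is
    injective when the integer i is not zero, again by characteristic zero
    ([geul_nilpotent_const]). An arrow
    commutes with nabla, so it preserves these spaces. *)

Set Implicit Arguments.
Unset Strict Implicit.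
Unset Printing Implicit Defensive.

Import GRing.Theory.
Local Open Scope ring_scope.
Local Open Scope quotient_scope.

(** * An equivalence criterion *)

Section Categories.

(** Lets the graded pieces of a filtration be replaced by the unit object
    itself. *)
Lemma cokernel_isomorphic (D : category) (a b q r : D) (f : hom a b)
    (p : hom b q) : is_cokernel f p -> isomorphic q r ->
  exists p' : hom b r, is_cokernel f p'.
Proof.
case=> -[z [g [h [z0 pf]]]] p_univ [s [t [ts st]]]; exists (comp s p); split.
  by exists z, (comp s g), h; split; rewrite // -!compA pf.
move=> c k /p_univ[l [lp l_uniq]]; exists (comp l t); split.
  by rewrite -compA (compA t) ts comp_idl.
move=> l' l'sp; rewrite (l_uniq (comp l' s)) -?compA ?st ?comp_idr //.
Qed.

(** The quasi-inverse picks a preimage [G y] of each [y] up to isomorphism, and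
    conjugates arrows by the chosen isomorphisms [s y] and [t y]. *)
Lemma ff_es_equivalence (D E : category) (F : functor D E) :
  (forall (a b : D) (g : hom (F a) (F b)), exists f, fmap F f = g) ->
  (forall (a b : D) (f f' : hom a b), fmap F f = fmap F f' -> f = f') ->
  (forall y : E, exists x : D, isomorphic (F x) y) ->
  is_equivalence F.
Proof.
move=> full faithful es.
pose G y := projT1 (cid (es y)).
have iso y : {st : hom (F (G y)) y * hom y (F (G y)) |
    comp st.2 st.1 = idm _ /\ comp st.1 st.2 = idm _}.
  by apply: cid; have [s [t st]] := projT2 (cid (es y)); exists (s, t).

pose s y := (sval (iso y)).1; pose t y := (sval (iso y)).2.
have ts y : comp (t y) (s y) = idm _ by have [] := svalP (iso y).
have st y : comp (s y) (t y) = idm _ by have [] := svalP (iso y).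
pose lift a b (g : hom (F a) (F b)) := sval (cid (full a b g)).
have liftE a b (g : hom (F a) (F b)) : fmap F (lift a b g) = g.
  exact: svalP (cid (full a b g)).
pose Gm y y' (h : hom y y') := lift _ _ (comp (t y') (comp h (s y))).
have Gid y : Gm y y (idm y) = idm (G y).
  by apply: faithful; rewrite liftE fmap_id comp_idl ts.
have Gcomp x y z (g : hom y z) (f : hom x y) :
    Gm _ _ (comp g f) = comp (Gm _ _ g) (Gm _ _ f).
  apply: faithful; rewrite fmap_comp !liftE -!compA; congr comp; congr comp.
  by rewrite (compA (s y)) st comp_idl.
exists (Functor Gid Gcomp); split.
  exists (fun a => lift _ _ (s (F a))); split=> [a|a b f].
    exists (lift _ _ (t (F a))); split; apply: faithful;
      by rewrite fmap_comp !liftE fmap_id ?ts ?st.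
  apply: faithful; rewrite !fmap_comp !liftE /=.
  by rewrite compA st comp_idl.
exists s; split=> [y|y y' h].
  by exists (t y); split; [exact: ts | exact: st].
by rewrite /= liftE compA st comp_idl.
Qed.

Definition full_inclusion (D : category) (P : D -> Prop) :
  functor (full_subcategory P) D :=
  @Functor (full_subcategory P) D sval (fun _ _ f => f)
    (fun _ => erefl) (fun _ _ _ _ _ => erefl).
End Categories.

(** * Triangular bases *)

Section TriangularBases.
Variables (C K : fieldType) (iota : C -> K) (theta : K -> K).
Hypothesis iota1 : iota 1 = 1.
Local Notation obj := (mc_obj iota theta).

Lemma mc_nablaD (M : obj) (v w : M) :
  mc_nabla (v + w) = mc_nabla v + mc_nabla w.
Proof. by have := mc_Clinear 1 v w; rewrite iota1 !scale1r. Qed.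

Lemma mc_nabla0 (M : obj) : mc_nabla (0 : M) = 0.
Proof. by apply: (addIr (mc_nabla (0 : M))); rewrite -mc_nablaD !add0r. Qed.

Lemma mc_nablaB (M : obj) (v w : M) :
  mc_nabla (v - w) = mc_nabla v - mc_nabla w.
Proof. by apply/eqP; rewrite eq_sym subr_eq -mc_nablaD subrK. Qed.

Lemma mc_nabla_sum (M : obj) n (F : 'I_n -> M) :
  mc_nabla (\sum_i F i) = \sum_i mc_nabla (F i).
Proof. exact: (big_morph _ (@mc_nablaD M) (mc_nabla0 M)). Qed.

Lemma mc_fun_sum (M N : obj) (f : mc_hom M N) n (F : 'I_n -> M) :
  mc_fun f (\sum_i F i) = \sum_i mc_fun f (F i).
Proof. exact: (big_morph _ (mc_funD f) (mc_fun0 f)). Qed.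

Fact mc_zero_linear (M N : obj) : linear (fun _ : M => 0 : N).
Proof. by move=> a u v; rewrite scaler0 addr0. Qed.

Definition mc_zero (M N : obj) : mc_hom M N :=
  MCHom (@mc_zero_linear M N) (fun=> esym (mc_nabla0 N)).

(** The range of the sum makes the matrix strictly triangular. Indexing by [nat]
    rather than by ['I_n] lets one [A] serve all the steps of a filtration. *)
Definition tri_family (M : obj) (A : nat -> nat -> C) n (u : nat -> M) : Prop :=
  forall j, (j < n)%N -> mc_nabla (u j) = \sum_(i < j) iota (A j i) *: u i.

Definition tri_basis (M : obj) (A : nat -> nat -> C) n (u : nat -> M) : Prop :=
  [/\ tri_family A n u,
      forall m, exists a : nat -> K, m = \sum_(i < n) a i *: u i &
      forall a : nat -> K, \sum_(i < n) a i *: u i = 0 ->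
        forall i, (i < n)%N -> a i = 0].

Lemma mc_hom_ext (M N : obj) A n (u : nat -> M) (f g : mc_hom M N) :
  tri_basis A n u ->
  (forall j, (j < n)%N -> mc_fun f (u j) = mc_fun g (u j)) -> f = g.
Proof.
move=> [_ span _] fg; apply: mc_hom_eq => m; have [a ->] := span m.
by rewrite !mc_fun_sum; apply: eq_bigr => i _; rewrite !mc_funZ fg.
Qed.

(** A triangular basis makes [M] the free object on a triangular family: the
    arrow sends coordinates to coordinates, and commutes with [mc_nabla] by the
    Leibniz rule. *)
Lemma tri_map (M N : obj) A n (u : nat -> M) (v : nat -> N) :
  tri_basis A n u -> tri_family A n v ->
  exists f : mc_hom M N, forall j, (j < n)%N -> mc_fun f (u j) = v j.
Proof.
move=> [uA span free] vA; have /choice[co coE] := span.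
have coP m (a : nat -> K) : m = \sum_(i < n) a i *: u i ->
    forall i, (i < n)%N -> co m i = a i.
  move=> me i lt_in; apply/eqP; rewrite -subr_eq0; apply/eqP.
  apply: (free (fun i => co m i - a i)) lt_in.
  under eq_bigr => l _ do rewrite scalerBl.
  by rewrite sumrB -coE -me subrr.
pose f m := \sum_(i < n) co m i *: v i.
have fE (a : nat -> K) : f (\sum_(i < n) a i *: u i) = \sum_(i < n) a i *: v i.
  by apply: eq_bigr => i _; rewrite (coP _ a).
have f_lin : linear f.
  move=> c m m'; rewrite (coE m) (coE m') !fE scaler_sumr -big_split /=.
  under eq_bigr => i _ do rewrite scalerA -scalerDl.
  rewrite (fE (fun i => c * co m i + co m' i)) scaler_sumr -big_split /=.
  by apply: eq_bigr => i _; rewrite scalerA scalerDl.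
have fD m m' : f (m + m') = f m + f m'.
  by have := f_lin 1 m m'; rewrite !scale1r.
have f0 : f 0 = 0 by apply: (addIr (f 0)); rewrite -fD !add0r.
have fZ c m : f (c *: m) = c *: f m.
  by have := f_lin c m 0; rewrite !addr0 f0 addr0.
have f_sum k (F : 'I_k -> M) : f (\sum_i F i) = \sum_i f (F i).
  exact: (big_morph _ fD f0).
have fu j : (j < n)%N -> f (u j) = v j.
  move=> lt_jn; have sumj (L : lmodType K) (w : nat -> L) :
      w j = \sum_(i < n) (i == j :> nat)%:R *: w i.
    rewrite (bigD1 (Ordinal lt_jn)) //= eqxx scale1r big1 ?addr0 // => i ne.
    by rewrite (_ : (i == j :> nat) = false) ?scale0r //; apply: negbTE.
  by rewrite (sumj _ u) (fE (fun i => (i == j)%:R)) -sumj.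
have f_nabla m : f (mc_nabla m) = mc_nabla (f m).
  rewrite (coE m) fE !mc_nabla_sum f_sum; apply: eq_bigr => i _.
  rewrite !mc_leibniz fD !fZ fu // uA // vA // f_sum.
  congr (_ + _ *: _); apply: eq_bigr => l _; rewrite fZ fu //.
  exact: ltn_trans (ltn_ord l) (ltn_ord i).
by exists (MCHom f_lin f_nabla).
Qed.

(** If every scalar is a constant up to a derivative, then so is every vector.
    By induction on the number of coordinates, with last one [iota c + theta h]:
    subtracting the derivative of [h *: u j] there leaves [iota c *: u j] and changes
    only earlier coordinates. *)
Lemma tri_solve (M : obj) A n (u : nat -> M) :
  (forall g : K, exists c h, g = iota c + theta h) ->
  tri_basis A n u ->
  forall w : M, exists (c : nat -> C) (v : M),
    w = \sum_(i < n) iota (c i) *: u i + mc_nabla v.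
Proof.
move=> prim [uA span _] w; have [a ->] := span w.
suff solve j (b : nat -> K) : (j <= n)%N -> exists (c : nat -> C) (v : M),
    \sum_(i < j) b i *: u i = \sum_(i < j) iota (c i) *: u i + mc_nabla v.
  exact: solve.
elim: j b => [|j IHj] b lt_jn.
  by exists (fun=> 0), 0; rewrite !big_ord0 mc_nabla0 addr0.
have [c [h bh]] := prim (b j).
have [d [v dv]] := IHj (fun i => b i - h * iota (A j i)) (ltnW lt_jn).
exists (fun i => if i == j then c else d i), (v + h *: u j).
rewrite !big_ord_recr /= eqxx mc_nablaD mc_leibniz uA // bh scalerDl.
rewrite [X in X + _ + _](eq_bigr (fun i : 'I_j => iota (d i) *: u i)); last first.
  by move=> i _; rewrite (ltn_eqF (ltn_ord i)).
rewrite addrACA.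
have -> : \sum_(i < j) b i *: u i
    = \sum_(i < j) (b i - h * iota (A j i)) *: u i
      + h *: \sum_(i < j) iota (A j i) *: u i.
  rewrite scaler_sumr -big_split; apply: eq_bigr => i _.
  by rewrite /= scalerA -scalerDl subrK.
by rewrite -dv addrACA [X in _ + X = _]addrC -addrA.
Qed.

Lemma tri_nabla_span (M : obj) A n (u : nat -> M) j (c : nat -> K) :
  tri_family A n u -> (j <= n)%N -> exists d : nat -> K,
    mc_nabla (\sum_(i < j) c i *: u i) = \sum_(i < j) d i *: u i.
Proof.
move=> uA; elim: j => [|j IHj] lt_jn.
  by exists (fun=> 0); rewrite !big_ord0 mc_nabla0.
have [d de] := IHj (ltnW lt_jn).
exists (fun i => if i == j then theta (c j) else d i + c j * iota (A j i)).
rewrite !big_ord_recr /= eqxx mc_nablaD de mc_leibniz uA // addrCA addrC.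
congr (_ + _); rewrite scaler_sumr -big_split; apply: eq_bigr => i _.
by rewrite (ltn_eqF (ltn_ord i)) scalerDl scalerA.
Qed.

(** A nonzero vector of the kernel whose last nonzero coordinate comes as early
    as possible, normalised so that this coordinate is 1, is horizontal: its
    derivative is in the kernel, and has lost that coordinate because 1 has
    derivative zero. So the kernel is trivial as soon as it has no nonzero
    horizontal vector. *)
Lemma horizontal_kernel (M N : obj) A n (u : nat -> M) (f : mc_hom M N) :
  theta 1 = 0 -> tri_basis A n u ->
  (forall w, mc_nabla w = 0 -> mc_fun f w = 0 -> w = 0) ->
  forall w, mc_fun f w = 0 -> w = 0.
Proof.
move=> theta1 [uA span _] hor w; have [a ->] := span w.
suff inj j (a' : nat -> K) : (j <= n)%N ->
    mc_fun f (\sum_(i < j) a' i *: u i) = 0 -> \sum_(i < j) a' i *: u i = 0.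
  exact: inj.
elim: j {a}a' => [|j IHj] a lt_jn; first by rewrite big_ord0.
rewrite big_ord_recr /=; have [-> | aj] := eqVneq (a j) 0.
  by rewrite scale0r addr0; apply: IHj; apply: ltnW.
move=> fw; set w' := _ + _ in fw *.
suff : (a j)^-1 *: w' = 0.
  by move/eqP; rewrite scaler_eq0 invr_eq0 (negbTE aj) => /eqP.
set b := fun i => (a j)^-1 * a i.
have w'E : (a j)^-1 *: w' = \sum_(i < j) b i *: u i + u j.
  rewrite /w' scalerDr scalerA mulVf // scale1r scaler_sumr; congr (_ + _).
  by apply: eq_bigr => i _; rewrite scalerA.
have fw' : mc_fun f ((a j)^-1 *: w') = 0 by rewrite mc_funZ fw scaler0.
apply: hor => //; rewrite w'E mc_nablaD uA //.
have [d de] := tri_nabla_span b uA (ltnW lt_jn).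
have dE : mc_nabla ((a j)^-1 *: w')
    = \sum_(i < j) (d i + iota (A j i)) *: u i.
  rewrite w'E mc_nablaD uA // de -big_split; apply: eq_bigr => i _.
  by rewrite /= scalerDl.
rewrite -uA // -mc_nablaD -w'E dE.
apply: (IHj (fun i => d i + iota (A j i)) (ltnW lt_jn)).
by rewrite -dE mc_fun_nabla fw' mc_nabla0.
Qed.

(** The basis of [N] is completed by a lift [m] of the generator of [Q]. As the
    derivative of [m] comes from [N], [tri_solve] gives a correction [v] for
    which the derivative of [m - f v] has constant coordinates. *)
Lemma tri_extend (N E Q : obj) A n (u : nat -> N) (f : mc_hom N E)
    (p : mc_hom E Q) (B : nat -> nat -> C) (e : nat -> Q) :
  (forall g : K, exists c h, g = iota c + theta h) ->
  tri_basis A n u -> tri_basis B 1 e ->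
  (forall w, mc_fun f w = 0 -> w = 0) ->
  (forall y, mc_fun p y = 0 <-> exists w, y = mc_fun f w) ->
  (exists y, mc_fun p y != 0) ->
  exists A' u', @tri_basis E A' n.+1 u'.
Proof.
move=> prim uA [eB espan efree] f_inj p_ker [y0 py0].
have [uT span free] := uA.
have pf w : mc_fun p (mc_fun f w) = 0 by apply/p_ker; exists w.
have [m pm] : exists m, mc_fun p m = e 0%N.
  have [a pa] := espan (mc_fun p y0); rewrite big_ord1 /= in pa.
  have a0 : a 0%N != 0.
    by apply: contraNneq py0 => a0; rewrite pa a0 scale0r.
  by exists ((a 0%N)^-1 *: y0); rewrite mc_funZ pa scalerA mulVf ?scale1r.
have [w mw] : exists w, mc_nabla m = mc_fun f w.
  by apply/p_ker; rewrite mc_fun_nabla pm eB // big_ord0.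
have [c [v wE]] := tri_solve prim uA w.
(* [c] gives the constant coordinates of the derivative of [m - f v] *)
exists (fun j i => if j == n then c i else A j i).
exists (fun j => if j == n then m - mc_fun f v else mc_fun f (u j)).
have u'E (a : nat -> K) : \sum_(i < n.+1)
    a i *: (if i == n :> nat then m - mc_fun f v else mc_fun f (u i))
    = mc_fun f (\sum_(i < n) a i *: u i) + a n *: (m - mc_fun f v).
  rewrite big_ord_recr /= eqxx mc_fun_sum; congr (_ + _).
  by apply: eq_bigr => i _; rewrite (ltn_eqF (ltn_ord i)) mc_funZ.
split=> [j|y|a].
- rewrite ltnS leq_eqVlt => /orP[/eqP->|lt_jn].
    rewrite eqxx mc_nablaB mw wE -mc_fun_nabla mc_funD addrK mc_fun_sum.
    by apply: eq_bigr => i _; rewrite (ltn_eqF (ltn_ord i)) mc_funZ.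
  rewrite (ltn_eqF lt_jn) -mc_fun_nabla uT // mc_fun_sum.
  apply: eq_bigr => i _.
  by rewrite (ltn_eqF (ltn_trans (ltn_ord i) lt_jn)) mc_funZ.
- have [b pb] := espan (mc_fun p y); rewrite big_ord1 /= in pb.
  have [x yx] : exists x, y - b 0%N *: (m - mc_fun f v) = mc_fun f x.
    by apply/p_ker; rewrite mc_funB mc_funZ mc_funB pf subr0 pm -pb subrr.
  have [a xa] := span x.
  pose c' i := if i == n then b 0%N else a i; exists c'.
  rewrite (u'E c') /c' eqxx; apply/eqP; rewrite -subr_eq yx; apply/eqP.
  rewrite xa; congr (mc_fun f _); apply: eq_bigr => i _.
  by rewrite (ltn_eqF (ltn_ord i)).
- rewrite u'E => a0 i.
  have an : a n = 0.
    apply: (efree (fun=> a n)) (ltnSn 0); rewrite big_ord1 /= -pm.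
    have := congr1 (mc_fun p) a0.
    by rewrite mc_funD pf add0r mc_funZ mc_funB pf subr0 mc_fun0.
  rewrite ltnS leq_eqVlt => /orP[/eqP->//|lt_in].
  move: a0; rewrite an scale0r addr0 => /f_inj/free; exact.
Qed.
End TriangularBases.

(** * Unipotent objects and triangular bases *)

Section UnipotentTriangular.
Variables (C K : fieldType) (iota : C -> K) (theta : K -> K).
Hypothesis iota1 : iota 1 = 1.
Hypothesis theta1 : theta 1 = 0.
Hypothesis primitive : forall g : K, exists c h, g = iota c + theta h.

(** [D] stands for End or for the regular singular connections, and [U] for its
    embedding in all the connections over [K]. Being a monomorphism, a zero
    arrow or a cokernel refers to [D] alone; the last two hypotheses provide
    enough objects of [D] to read these notions on vectors. *)
Variables (D : category) (U : functor D (MC iota theta)) (one : D).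
Hypothesis U_full : forall (a b : D) (g : hom (U a) (U b)),
  exists f : hom a b, fmap U f = g.
Hypothesis U_faithful : forall (a b : D) (f f' : hom a b),
  fmap U f = fmap U f' -> f = f'.
Hypothesis U_one : exists A (e : nat -> (U one : mc_obj _ _)), tri_basis A 1 e.
Hypothesis U_tri : forall A n,
  exists (T : D) (u : nat -> (U T : mc_obj _ _)), tri_basis A n u.
Hypothesis U_coker : forall (a b : D) (f : hom a b),
  exists (q : D) (g : hom b q), forall y : (U b : mc_obj _ _),
    mc_fun (fmap U g) y = 0 <-> exists x, y = mc_fun (fmap U f) x.

Let UO (a : D) : mc_obj iota theta := U a.
Let Uf (a b : D) (f : hom a b) : mc_hom (UO a) (UO b) := fmap U f.

Let Uf_comp a b c (g : hom b c) (f : hom a b) m :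
  mc_fun (Uf (comp g f)) m = mc_fun (Uf g) (mc_fun (Uf f) m).
Proof. by rewrite /Uf fmap_comp. Qed.

Let Uf_id a m : mc_fun (Uf (idm a)) m = m.
Proof. by rewrite /Uf fmap_id. Qed.

Let Uf_inj a b (f g : hom a b) : mc_fun (Uf f) =1 mc_fun (Uf g) -> f = g.
Proof. by move=> fg; apply: U_faithful; apply: mc_hom_eq. Qed.

Let Uf_lift a b (g : mc_hom (UO a) (UO b)) : exists f : hom a b, Uf f = g.
Proof. exact: U_full. Qed.

(** The only endomorphism of a zero object is zero, hence the identity is
    zero. *)
Lemma zero_objectP z : is_zero_object z <-> forall m : UO z, m = 0.
Proof.
split=> [z0 m|z0 a].
  have [f fE] := Uf_lift (mc_zero iota1 (UO z) (UO z)).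
  have [_ [k [_ k_uniq]]] := z0 z.
  by rewrite -(Uf_id m) -(k_uniq (idm z) I) (k_uniq f I) fE.
have [f fE] := Uf_lift (mc_zero iota1 (UO a) (UO z)).
have [g gE] := Uf_lift (mc_zero iota1 (UO z) (UO a)).
split; [exists f|exists g]; split=> // k _; apply: Uf_inj => m.
  by rewrite (z0 (mc_fun _ _)) (z0 (mc_fun (Uf k) m)).
by rewrite (z0 m) !mc_fun0.
Qed.

(** A triangular basis with no element provides a zero object, through which
    every arrow that vanishes on vectors factors. *)
Lemma zero_arrowP (a b : D) (f : hom a b) :
  is_zero_arrow f <-> forall m, mc_fun (Uf f) m = 0.
Proof.
split=> [[z [g [h [z0 ->]]]] m|f0].
  by rewrite Uf_comp ((zero_objectP z).1 z0 (mc_fun (Uf h) m)) mc_fun0.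
have [z [u [_ span _]]] := U_tri (fun _ _ => 0) 0.
have z0 (m : UO z) : m = 0 by have [c ->] := span m; rewrite big_ord0.
have [g gE] := Uf_lift (mc_zero iota1 (UO a) (UO z)).
have [h hE] := Uf_lift (mc_zero iota1 (UO z) (UO b)).
exists z, h, g; split; first exact/zero_objectP.
by apply: Uf_inj => m; rewrite Uf_comp hE f0.
Qed.

(** A horizontal vector of the source is an arrow from the unit object. If [f]
    kills it, cancelling the monomorphism [f] against the zero arrow shows that
    it is zero; [horizontal_kernel] then covers the other vectors. *)
Lemma mono_kernel (a b : D) (f : hom a b) A n (u : nat -> UO a) :
  tri_basis A n u -> is_mono f ->
  forall w, mc_fun (Uf f) w = 0 -> w = 0.
Proof.
move=> uA f_mono; apply: (horizontal_kernel iota1 theta1 uA) => w dw fw.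
have [B [e eB]] := U_one.
have [|k ke] := tri_map iota1 eB (v := (fun=> w) : nat -> UO a).
  by case=> // _; rewrite big_ord0.
have [k' k'E] := @Uf_lift one a k.
have [z zE] := @Uf_lift one a (mc_zero iota1 _ _).
have fk : comp f k' = comp f z.
  apply: U_faithful; apply: (mc_hom_ext eB) => -[|//] _.
  by rewrite !Uf_comp k'E zE ke // fw mc_fun0.
by rewrite -(ke 0%N) // -[k]k'E (f_mono _ _ _ fk) zE.
Qed.

(** Being a cokernel is only a universal property; testing it on the concrete
    quotient of [b] by the image of [f] shows that nothing else is killed. *)
Lemma cokernel_kernel (a b q : D) (f : hom a b) (p : hom b q) :
  is_cokernel f p ->
  forall y, mc_fun (Uf p) y = 0 <-> exists x, y = mc_fun (Uf f) x.
Proof.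
case=> /zero_arrowP pf p_univ y; split=> [py|[x ->]]; last by rewrite -Uf_comp.
have [r [g gE]] := U_coker f.
have /p_univ[h [hp _]] : is_zero_arrow (comp g f).
  by apply/zero_arrowP => m; rewrite Uf_comp; apply/gE; exists m.
by apply/gE; rewrite -/(Uf g) -hp Uf_comp py mc_fun0.
Qed.

(** Otherwise both the identity and the zero arrow of [q] would factor [p]
    through itself. *)
Lemma cokernel_neq0 (a b q : D) (f : hom a b) (p : hom b q) (e : UO q) :
  is_cokernel f p -> e != 0 -> exists y, mc_fun (Uf p) y != 0.
Proof.
case=> p0 p_univ e0; apply: contrapT => /forallNP p_eq0.
have pz m : mc_fun (Uf p) m = 0 by apply/eqP/negPn/negP; apply: p_eq0.
have [z zE] := Uf_lift (mc_zero iota1 (UO q) (UO q)).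
have [h [_ h_uniq]] := p_univ _ p p0.
have z_id : z = idm q.
  rewrite -(h_uniq z) ?(h_uniq (idm q)) ?comp_idl //.
  by apply: Uf_inj => m; rewrite Uf_comp zE pz.
by move/eqP: e0; rewrite -(Uf_id e) -z_id zE.
Qed.

(** By induction along the filtration: [mono_kernel], [cokernel_kernel] and
    [cokernel_neq0] turn each step into an exact sequence of vector spaces, to
    which [tri_extend] applies. *)
Lemma unipotent_tri (X : D) :
  unipotent one X -> exists A n u, @tri_basis _ _ iota theta (UO X) A n u.
Proof.
case=> n [fil [i [fil0 [s [t [ts st]]] filS]]].
have [A [u uA]] : exists A u, @tri_basis _ _ iota theta (UO (fil n)) A n u.
  elim: {-2}n (leqnn n) => [|k IHk] lt_kn.
    exists (fun _ _ => 0), (fun=> 0); split=> // m.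
    by exists (fun=> 0); rewrite big_ord0; apply: (zero_objectP _).1.
  have [A [u uA]] := IHk (ltnW lt_kn).
  have [i_mono [gr [p [p_coker gr_one]]]] := filS _ lt_kn.
  have [p' p'_coker] := cokernel_isomorphic p_coker gr_one.
  have [B [e eB]] := U_one.
  have e0 : e 0%N != 0.
    have [_ _ free] := eB; apply/eqP => e0.
    have := free (fun=> 1) _ 0%N isT; rewrite big_ord1 e0 scaler0 => /(_ erefl).
    by move/eqP; rewrite oner_eq0.
  apply: (tri_extend iota1 primitive uA eB (f := Uf (i k)) (p := Uf p')).
  - exact: mono_kernel uA i_mono.
  - exact: cokernel_kernel p'_coker.
  - exact: cokernel_neq0 p'_coker e0.
have [uT span free] := uA.
exists A, n, (fun j => mc_fun (Uf s) (u j)).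
have tsE m : mc_fun (Uf t) (mc_fun (Uf s) m) = m by rewrite -Uf_comp ts Uf_id.
have stE m : mc_fun (Uf s) (mc_fun (Uf t) m) = m by rewrite -Uf_comp st Uf_id.
have sE (a : nat -> K) : \sum_(j < n) a j *: mc_fun (Uf s) (u j)
    = mc_fun (Uf s) (\sum_(j < n) a j *: u j).
  by rewrite mc_fun_sum; apply: eq_bigr => j _; rewrite mc_funZ.
split=> [j lt_jn|m|a].
- rewrite -mc_fun_nabla uT // mc_fun_sum.
  by apply: eq_bigr => l _; rewrite mc_funZ.
- have [a ma] := span (mc_fun (Uf t) m); exists a.
  by rewrite sE -ma stE.
- rewrite sE => /(congr1 (mc_fun (Uf t))); rewrite tsE mc_fun0; exact: free.
Qed.

(** The two arrows given by [tri_map] are inverse to each other on the bases,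
    hence everywhere. *)
Lemma tri_isomorphic (X Y : D) A n (u : nat -> UO X) (v : nat -> UO Y) :
  tri_basis A n u -> tri_basis A n v -> isomorphic X Y.
Proof.
move=> uA vA; have [[uT _ _] [vT _ _]] := (uA, vA).
have [f fu] := tri_map iota1 uA vT; have [g gv] := tri_map iota1 vA uT.
have [f' f'E] := Uf_lift f; have [g' g'E] := Uf_lift g.
exists f', g'; split; apply: U_faithful.
  apply: (mc_hom_ext uA) => j lt_jn.
  by rewrite -!/(Uf _) Uf_comp Uf_id f'E g'E fu // gv.
apply: (mc_hom_ext vA) => j lt_jn.
by rewrite -!/(Uf _) Uf_comp Uf_id f'E g'E gv // fu.
Qed.

(** The inclusion of the span of the first [n] vectors has for cokernel the
    coordinate on the last one. A map [g] that kills the first [n] vectors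
    sends the last one to a horizontal vector, which is an arrow from the unit
    object. *)
Lemma tri_step (X Y : D) A n (u : nat -> UO X) (v : nat -> UO Y) (f : hom X Y) :
  tri_basis A n u -> tri_basis A n.+1 v ->
  (forall j, (j < n)%N -> mc_fun (Uf f) (u j) = v j) ->
  is_mono f /\ exists p : hom Y one, is_cokernel f p.
Proof.
move=> uA vA fu; have [[uT uspan ufree] [vT vspan vfree]] := (uA, vA).
have fE (a : nat -> K) : mc_fun (Uf f) (\sum_(i < n) a i *: u i)
    = \sum_(i < n) a i *: v i.
  by rewrite mc_fun_sum; apply: eq_bigr => i _; rewrite mc_funZ fu.
have f_inj w : mc_fun (Uf f) w = 0 -> w = 0.
  have [a ->] := uspan w; rewrite fE => a0.
  apply: big1 => i _.
  rewrite (_ : a i = 0) ?scale0r //.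
  have /= := vfree (fun i => if (i < n)%N then a i else 0) _ i _.
  rewrite ltn_ord => -> //; last exact: ltnW (ltn_ord i).
  rewrite big_ord_recr /= ltnn scale0r addr0 -[RHS]a0.
  by apply: eq_bigr => l _; rewrite ltn_ord.
split.
  move=> Z k l fkl; apply: Uf_inj => m; apply/eqP; rewrite -subr_eq0; apply/eqP.
  by apply: f_inj; rewrite mc_funB -!Uf_comp fkl subrr.
have [B [e eB]] := U_one; have [eT espan efree] := eB.
have [|p0 p0v] := tri_map iota1 vA
    (v := (fun j => if j == n then e 0%N else 0) : nat -> UO one).
  move=> j; rewrite ltnS => le_jn.
  rewrite big1 => [|i _]; last first.
    by rewrite (ltn_eqF (leq_trans (ltn_ord i) le_jn)) scaler0.
  by case: eqP => _; rewrite ?mc_nabla0 // eT // big_ord0.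
have [p pE] := Uf_lift p0; exists p.
have pv j : (j < n.+1)%N -> mc_fun (Uf p) (v j) = if j == n then e 0%N else 0.
  by rewrite pE; apply: p0v.
split.
  apply/zero_arrowP => m; have [a ->] := uspan m.
  rewrite Uf_comp fE mc_fun_sum big1 // => i _.
  by rewrite mc_funZ pv ?ltn_eqF ?scaler0 // ltnW // ltnS.
move=> Z g /zero_arrowP gf.
have gv j : (j < n)%N -> mc_fun (Uf g) (v j) = 0.
  by move=> lt_jn; rewrite -fu // -Uf_comp.
have [|h0 h0e] := tri_map iota1 eB
    (v := (fun=> mc_fun (Uf g) (v n)) : nat -> UO Z).
  case=> // _; rewrite big_ord0 -mc_fun_nabla vT // mc_fun_sum big1 // => i _.
  by rewrite mc_funZ gv // scaler0.
have [h hE] := Uf_lift h0; exists h; split.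
  apply: U_faithful; apply: (mc_hom_ext vA) => j.
  rewrite ltnS leq_eqVlt => /orP[/eqP->|lt_jn]; rewrite -!/(Uf _) Uf_comp.
    by rewrite pv // eqxx hE h0e.
  by rewrite pv ?(ltn_eqF lt_jn) ?mc_fun0 ?gv // ltnW // ltnS.
move=> h' h'p; apply: U_faithful; apply: (mc_hom_ext eB) => -[|//] _.
rewrite -!/(Uf _) hE h0e // -h'p Uf_comp pv // eqxx //.
Qed.

(** The filtration is by objects with the upper left corners of [A] for
    matrices, which avoids constructing subobjects of [X]. *)
Lemma tri_unipotent (X : D) A n (u : nat -> UO X) :
  tri_basis A n u -> unipotent one X.
Proof.
move=> uA; have /choice[T T_tri] := U_tri A.
pose t k := sval (cid (T_tri k)).
have tA k : tri_basis A k (t k) := svalP (cid (T_tri k)).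
have inc k : exists f : hom (T k) (T k.+1),
    forall j, (j < k)%N -> mc_fun (Uf f) (t k j) = t k.+1 j.
  have [|f0 f0t] := tri_map iota1 (tA k) (v := t k.+1).
    by move=> j lt_jk; have [tT _ _] := tA k.+1; apply: tT; apply: ltnW.
  by have [f fE] := Uf_lift f0; exists f => j lt_jk; rewrite fE f0t.
pose i k := sval (cid (inc k)).
have iE k j : (j < k)%N -> mc_fun (Uf (i k)) (t k j) = t k.+1 j.
  exact: (svalP (cid (inc k))).
exists n, T, i; split.
- by apply/zero_objectP => m; have [_ span _] := tA 0; have [a ->] := span m;
    rewrite big_ord0.
- exact: tri_isomorphic (tA n) uA.
move=> k _; have [i_mono [p p_coker]] := tri_step (tA k) (tA k.+1) (iE k).
split=> //; exists one, p; split=> //.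
by exists (idm one), (idm one); rewrite comp_idl.
Qed.
End UnipotentTriangular.

(** * Endomorphisms as connections over the constants *)

Section EndConnection.
Variable C : fieldType.
Local Notation End_MC := (MC (fun c : C => c) (fun _ : C => 0)).

Section Object.
Variable V : EndCat C.

Fact end_mc_fin : finitely_generated (V : lmodType C).
Proof.
exists (\dim (@fullv C V)), (fun i => (vbasis fullv)`_i) => v.
exists (fun i => coord (vbasis fullv) i v).
exact: coord_vbasis (memvf v).
Qed.

Fact end_mc_leibniz (c : C) (v : V) :
  end_map V (c *: v) = 0 *: v + c *: end_map V v.
Proof. by rewrite scale0r add0r linearZ. Qed.

(** Over the field [C] with zero derivation, the Leibniz rule is linearity. *)
Definition end_mc_obj : End_MC :=
  @MCObj C C (fun c : C => c) (fun _ : C => 0) V (end_map V) end_mc_fin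
    (fun c v w => linearP (end_map V) c v w) end_mc_leibniz.
End Object.

Section Hom.
Variables (V W : EndCat C) (f : hom V W).

Fact end_mc_linear : linear (end_fun f).
Proof. by move=> c v w; rewrite linearP. Qed.

Fact end_mc_nabla v : end_fun f (end_map V v) = end_map W (end_fun f v).
Proof. by have /lfunP/(_ v) := end_funP f; rewrite !comp_lfunE. Qed.

Definition end_mc_hom : hom (end_mc_obj V) (end_mc_obj W) :=
  @MCHom _ _ _ _ (end_mc_obj V) (end_mc_obj W) _ end_mc_linear end_mc_nabla.
End Hom.

Definition end_mc : functor (EndCat C) End_MC.
Proof.
refine (@Functor (EndCat C) End_MC end_mc_obj end_mc_hom _ _).
- by move=> V; apply: mc_hom_eq => v; rewrite /= id_lfunE.
- by move=> V W X g f; apply: mc_hom_eq => v; rewrite /= comp_lfunE.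
Defined.

Lemma end_mc_full (V W : EndCat C) (g : hom (end_mc V) (end_mc W)) :
  exists f : hom V W, fmap end_mc f = g.
Proof.
pose f0 : V -> W := mc_fun g.
have f0_lin : linear f0 by exact: (mc_fun_linear g).
pose f1 := linfun (HB.pack_for {linear V -> W} f0
                    (GRing.isLinear.Build _ _ _ _ f0 f0_lin)).
have f1E v : f1 v = f0 v by rewrite lfunE.
have f1P : (end_map W \o f1 = f1 \o end_map V)%VF.
  by apply/lfunP => v; rewrite !comp_lfunE !f1E; apply/esym/(mc_fun_nabla g).
by exists (EndHom f1P : hom V W); apply: mc_hom_eq => v; apply: f1E.
Qed.

Lemma end_mc_faithful (V W : EndCat C) (f g : hom V W) :
  fmap end_mc f = fmap end_mc g -> f = g.
Proof.
move=> fg; apply: end_hom_eq; apply/lfunP => v.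
exact: (congr1 (fun h : hom (end_mc_obj V) (end_mc_obj W) => mc_fun h v) fg).
Qed.

Lemma end_mc_unit : exists A (e : nat -> (end_mc (end_unit C) : mc_obj _ _)),
  tri_basis A 1 e.
Proof.
exists (fun _ _ => 0), (fun=> 1 : C^o); split=> [[]//|m|a].
- by rewrite big_ord0 /= lfunE.
- by exists (fun=> m); rewrite big_ord1 /= [_ *: _]mulr1.
- by rewrite big_ord1 [_ *: _]mulr1 => a0 [].
Qed.

(** Endomorphisms act on row vectors, so row [j] of the strictly lower
    triangular matrix [L] is the image of the [j]-th basis vector. *)
Lemma end_mc_tri (A : nat -> nat -> C) n :
  exists (T : EndCat C) (u : nat -> (end_mc T : mc_obj _ _)), tri_basis A n u.
Proof.
pose L : 'M[C]_n := \matrix_(j, i) if (i < j)%N then A j i else 0.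
pose T : EndCat C := @EndObj C 'rV[C]_n (linfun (mulmxr L)).
pose u j : 'rV[C]_n := \row_i (i == j :> nat)%:R.
have uE (a : nat -> C) : \sum_(i < n) a i *: u i = \row_i a i.
  apply/rowP => k; rewrite summxE mxE (bigD1 k) //= !mxE eqxx mulr1.
  rewrite big1 ?addr0 // => i ne; rewrite !mxE (_ : (_ == _) = false) ?mulr0 //.
  by apply/negbTE; rewrite eq_sym.
exists T, u; split=> [j lt_jn|m|a].
- rewrite /= lfunE /=.
  transitivity (\sum_(i < n) (if (i < j)%N then A j i else 0) *: u i).
    rewrite (uE (fun i => if (i < j)%N then A j i else 0)).
    apply/rowP => k; rewrite !mxE (bigD1 (Ordinal lt_jn)) //= !mxE.
    rewrite eqxx mul1r big1 ?addr0 // => i ne.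
    by rewrite !mxE (_ : (_ == _) = false) ?mul0r //; apply/negbTE.
  rewrite (big_ord_widen n (fun i => A j i *: u i)) ?(ltnW lt_jn) //.
  rewrite [RHS]big_mkcond; apply: eq_bigr => i _.
  by case: ifP; rewrite ?scale0r.
- pose a k := if insub k is Some i then (m : 'rV_n) 0 i else 0.
  exists a; rewrite uE; apply/rowP => k; rewrite mxE /a.
  by rewrite insubT //= => lt; congr (m _ _); apply: val_inj.
- rewrite uE => /rowP a0 i lt_in.
  by have := a0 (Ordinal lt_in); rewrite !mxE.
Qed.

(** The quotient by the image of [f] is realised on [W] itself: with [g0] the
    projection along the image, the endomorphism [g0 \o end_map W] is compatible
    with [g0], because the image of [f] is stable. *)
Lemma end_mc_coker (V W : EndCat C) (f : hom V W) :
  exists (Q : EndCat C) (g : hom W Q), forall y : (end_mc W : mc_obj _ _),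
    mc_fun (fmap end_mc g) y = 0 <-> exists v, y = mc_fun (fmap end_mc f) v.
Proof.
pose pr := projv (limg (end_fun f)).
pose g0 : 'End(W) := \1%VF - pr.
pose B : 'End(W) := (g0 \o end_map W)%VF.
have g0E y : g0 y = y - pr y by rewrite /g0 add_lfunE opp_lfunE id_lfunE.
have g0f v : g0 (end_fun f v) = 0.
  by rewrite g0E projv_id ?subrr // memv_img ?memvf.
have g0P : (end_map (EndObj B) \o g0 = g0 \o end_map W)%VF.
  apply/lfunP => w; rewrite /= !comp_lfunE (g0E w) !linearB /=.
  have /memv_imgP[v _ ->] : pr w \in limg (end_fun f) by apply: memv_proj.
  by rewrite -end_mc_nabla g0f subr0.
exists (EndObj B), (EndHom g0P) => y; split=> [gy|[v ->]]; last exact: g0f.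
have /memv_imgP[v _ yv] : pr y \in limg (end_fun f) by apply: memv_proj.
exists v; rewrite /= -yv; apply/eqP; rewrite -subr_eq0 -g0E; exact/eqP.
Qed.
End EndConnection.

(** * Quotients of lattices *)

Section ModuleQuotient.
Variables (R : comNzRingType) (M : lmodType R) (S : {pred M}).
Hypothesis S_closed : submod_closed S.

(** A name for [S] that carries the proof of its closure properties, so that the
    quotient structures can be found by inference. *)
Definition mod_sub & submod_closed S : {pred M} := S.
HB.instance Definition _ :=
  GRing.isSubmodClosed.Build R M (mod_sub S_closed) S_closed.

Definition mod_quot : Type := Quotient.quot (mod_sub S_closed).
HB.instance Definition _ := GRing.Zmodule.on mod_quot.
HB.instance Definition _ := EqQuotient.on mod_quot.

Definition mod_proj (m : M) : mod_quot := \pi_mod_quot m.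

Definition mod_repr (q : mod_quot) : M := repr q.

Lemma mod_reprK : cancel mod_repr mod_proj.
Proof. exact: reprK. Qed.

Lemma mod_projP q : exists m, q = mod_proj m.
Proof. by exists (mod_repr q); rewrite mod_reprK. Qed.

Lemma mod_projD : {morph mod_proj : m n / m + n}.
Proof. exact: Quotient.pi_add. Qed.

Lemma mod_proj0 : mod_proj 0 = 0.
Proof. by apply: (addIr (mod_proj 0)); rewrite -mod_projD !add0r. Qed.

Lemma mod_projE m n : mod_proj m = mod_proj n <-> m - n \in S.
Proof.
rewrite -[_ \in S]/(_ \in mod_sub S_closed) Quotient.idealrBE.
by split=> [/eqP//|/eqP].
Qed.

Definition mod_scale a (q : mod_quot) : mod_quot := mod_proj (a *: mod_repr q).

Lemma mod_scaleE a m : mod_scale a (mod_proj m) = mod_proj (a *: m).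
Proof.
apply/mod_projE; rewrite -scalerBr.
rewrite -[_ \in S]/(_ \in mod_sub S_closed) rpredZ //.
by apply/mod_projE; rewrite mod_reprK.
Qed.

Fact mod_scaleA a b q : mod_scale a (mod_scale b q) = mod_scale (a * b) q.
Proof. by case: (mod_projP q) => m ->; rewrite !mod_scaleE scalerA. Qed.
Fact mod_scale1 : left_id 1 mod_scale.
Proof. by move=> q; case: (mod_projP q) => m ->; rewrite mod_scaleE scale1r. Qed.
Fact mod_scaleDr : right_distributive mod_scale +%R.
Proof.
move=> a q r; case: (mod_projP q) (mod_projP r) => m -> [n ->].
by rewrite -mod_projD !mod_scaleE scalerDr mod_projD.
Qed.
Fact mod_scaleDl q : {morph mod_scale^~ q : a b / a + b}.
Proof.
move=> a b; case: (mod_projP q) => m ->.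
by rewrite !mod_scaleE scalerDl mod_projD.
Qed.

HB.instance Definition _ := GRing.Zmodule_isLmodule.Build R mod_quot
  mod_scaleA mod_scale1 mod_scaleDr mod_scaleDl.

Lemma mod_projZ a m : mod_proj (a *: m) = a *: mod_proj m.
Proof. by rewrite -mod_scaleE. Qed.
End ModuleQuotient.

Section LatticeQuotient.
Variables (C : fieldType) (X : MClaurent C) (L : MClog C).
Variable f : hom X (gamma C L).

(** The vectors of the lattice [L] that lie in the image of [f]. The quotient of
    the generic fibre of [L] by this image is the generic fibre of the quotient
    of [L] by this trace, which makes it regular singular. *)
Definition lattice_trace : {pred L} :=
  fun l => `[< exists x, mc_fun f x = xfrac l 0 >].

Lemma lattice_traceP l :
  l \in lattice_trace <-> exists x, mc_fun f x = xfrac l 0.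
Proof. by split=> [/asboolP|?]; [|apply/asboolP]. Qed.

Fact lattice_trace_closed : submod_closed lattice_trace.
Proof.
split=> [|a l m /lattice_traceP[x fx] /lattice_traceP[y fy]].
  by apply/lattice_traceP; exists 0; rewrite mc_fun0 xfrac0.
apply/lattice_traceP; exists (lfrac a 0 *: x + y).
by rewrite mc_fun_linear fx fy [_ *: _](lfracZ a 0 l 0) xfracDk.
Qed.

Fact lattice_trace_nabla l :
  l \in lattice_trace -> mc_nabla l \in lattice_trace.
Proof.
case/lattice_traceP => x fx; apply/lattice_traceP; exists (mc_nabla x).
rewrite mc_fun_nabla fx /= xloc_nablaE.
- by rewrite mulr0n subr0.
- exact: mc_leibniz.
Qed.

Local Notation Q := (mod_quot lattice_trace_closed).
Local Notation proj := (mod_proj lattice_trace_closed).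

Definition quot_nabla (q : Q) : Q := proj (mc_nabla (mod_repr q)).

Lemma quot_nablaE l : quot_nabla (proj l) = proj (mc_nabla l).
Proof.
apply/mod_projE.
have nB (u v : L) : mc_nabla (u - v) = mc_nabla u - mc_nabla v.
  have := mc_Clinear (-1 : C) v u.
  have -> : ps_const (-1 : C) = -1.
    by apply/pseriesP => -[|n] //=; rewrite oppr0.
  by rewrite !scaleN1r addrC [in RHS]addrC.
rewrite -nB lattice_trace_nabla //.
by apply/(mod_projE lattice_trace_closed); rewrite mod_reprK.
Qed.

Fact quot_fin : finitely_generated (Q : lmodType (pseries C)).
Proof.
have [n [e span]] := mc_fin L; exists n, (fun i => proj (e i)) => q.
have [l ->] := mod_projP q; have [a ->] := span l; exists a.
rewrite (big_morph proj (mod_projD lattice_trace_closed) (mod_proj0 _)).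
by apply: eq_bigr => i _; rewrite mod_projZ.
Qed.

Fact quot_Clinear c (q r : Q) :
  quot_nabla (ps_const c *: q + r) = ps_const c *: quot_nabla q + quot_nabla r.
Proof.
case: (mod_projP q) (mod_projP r) => m -> [n ->].
by rewrite -mod_projZ -mod_projD !quot_nablaE mc_Clinear mod_projD mod_projZ.
Qed.

Fact quot_leibniz a (q : Q) :
  quot_nabla (a *: q) = ps_theta a *: q + a *: quot_nabla q.
Proof.
case: (mod_projP q) => m ->.
by rewrite -mod_projZ !quot_nablaE mc_leibniz mod_projD !mod_projZ.
Qed.

Definition lattice_quot : MClog C :=
  MCObj quot_fin quot_Clinear quot_leibniz.

Fact lattice_proj_linear : linear (proj : L -> lattice_quot).
Proof. by move=> a u v; rewrite mod_projD mod_projZ. Qed.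

Definition lattice_proj : hom L lattice_quot :=
  @MCHom _ _ _ _ L lattice_quot proj lattice_proj_linear
    (fun l => esym (quot_nablaE l)).

(** As x is inverted on the generic fibre, a fraction l / x^k is killed when some
    x^n l lies in the trace, and then l / x^k is itself in the image of [f]. *)
Lemma lattice_proj_kernel y :
  mc_fun (fmap (gamma C) lattice_proj) y = 0 <-> exists x, y = mc_fun f x.
Proof.
case: (xlocP y) => l k.
rewrite [mc_fun _ _](gamma_funE lattice_proj) -(xfrac0 _ 0).
have projE a : (proj a = 0) <-> a \in lattice_trace.
  by rewrite -(mod_proj0 lattice_trace_closed) mod_projE subr0.
split=> [/xfracE[n]|[x yx]].
  rewrite addn0 scaler0 -mod_projZ => /projE/lattice_traceP[x fx].
  exists (lfrac 1 (n + k) *: x); rewrite mc_funZ fx [_ *: _]lfracZ scale1r addn0.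
  by rewrite xfrac_cancel.
apply/xfracE; exists 0%N; rewrite scaler0 scale1r; apply/projE/lattice_traceP.
exists (lfrac (psX C ^+ k) 0 *: x); rewrite mc_funZ -yx [_ *: _]lfracZ.
by rewrite [(0 + k)%N]addnC xfrac_cancel.
Qed.
End LatticeQuotient.

(** * Power series and Laurent series *)

Section PseriesShift.
Variables (C : fieldType) (V : lmodType C).
Implicit Types s : pseries V.

Lemma pcoefXnZ n s k :
  pcoef (psX C ^+ n *: s) k = if (k < n)%N then 0 else pcoef s (k - n)%N.
Proof.
elim: n k => [|n IHn] k; first by rewrite scale1r subn0.
rewrite exprS -scalerA; move: (_ *: s) IHn => t IHn; rewrite pcoefZ.
case: k => [|k]; first by rewrite big_ord1 scale0r.
rewrite !big_ord_recl scale0r scale1r add0r big1 ?addr0 => [|i _].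
  by rewrite /= subn1 IHn.
by rewrite scale0r.
Qed.

Lemma xfrac_eq0 s k : xfrac s k = 0 -> s = 0.
Proof.
rewrite -(xfrac0 _ 0) => /xfracE[n]; rewrite addn0 scaler0 => /pseriesP s0.
apply/pseriesP => i; have := s0 (n + i)%N.
by rewrite pcoefXnZ ltnNge leq_addr addKn.
Qed.

Lemma xfrac_sum k n (F : 'I_n -> pseries V) :
  xfrac (\sum_i F i) k = \sum_i xfrac (F i) k.
Proof.
exact: (big_morph _ (fun s t => esym (xfracDk s t k)) (xfrac0 _ k)).
Qed.

Lemma common_denominator n (a : nat -> laurent C) :
  exists k (f : nat -> pseries C), forall i, (i < n)%N -> a i = lfrac (f i) k.
Proof.
elim: n => [|n [k [f fa]]]; first by exists 0%N, (fun=> 0).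
case e: (a n) / (laurentP (a n)) => [g l].
exists (l + k)%N, (fun i => if i == n then psX C ^+ k * g else psX C ^+ l * f i).
move=> i; rewrite ltnS leq_eqVlt => /orP[/eqP->|lt_in].
  by rewrite eqxx e addnC; apply/esym/(@xfrac_cancel C (pseries C)^o).
rewrite (ltn_eqF lt_in) fa //; exact/esym/(@xfrac_cancel C (pseries C)^o).
Qed.
End PseriesShift.

Section LaurentPrimitive.
Variable C : fieldType.
Hypothesis charC : [pchar C] =i pred0.

Lemma natr_inj : injective (fun n => n%:R : C).
Proof.
have natr0 n : n%:R = 0 :> C -> n = 0%N.
  by move/eqP; rewrite ((pcharf0P C).1 charC) => /eqP.
suff le m n : (m <= n)%N -> m%:R = n%:R :> C -> m = n.
  move=> m n e; have [/le|/ltnW/le->//] := leqP m n; exact.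
move=> le_mn e; apply/eqP; rewrite eqn_leq le_mn -subn_eq0.
by rewrite (natr0 (n - m)%N) // natrB // e subrr.
Qed.

(** Only the coefficient of x^0 fails to be integrable: on x^i, theta is
    multiplication by i. *)
Lemma laurent_primitive (g : laurent C) : exists c h, g = lconst c + ltheta h.
Proof.
case: (laurentP g) => f k.
exists (pcoef f k).
(* theta multiplies the coefficient of x^(n - k) by n - k *)
exists (lfrac (Pseries (fun n => pcoef f n / (n%:R - k%:R))) k).
apply/lcoefP => i; rewrite lcoefD lcoef_ltheta !lcoef_lfrac addr0.
have const_neq0 : i != 0 ->
    (if i is Posz n then pcoef (ps_const (pcoef f k)) n else 0) = 0.
  by case: (i) => [[]|].
case e: (i + k%:Z) => [n|n]; last first.
  by rewrite mul0rz addr0 const_neq0 //; apply/eqP => i0; rewrite i0 add0r in e.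
have ei : i = n%:Z - k%:Z by rewrite -e addrK.
have [nk|ne_nk] := eqVneq n k.
  by rewrite ei nk subrr mulr0z addr0.
rewrite const_neq0 ?add0r; last by rewrite ei subr_eq0.
rewrite ei -mulrzr intrB /= divfK //.
by rewrite subr_eq0; apply: contraNneq ne_nk => /natr_inj->.
Qed.

Lemma ltheta1 : ltheta (1 : laurent C) = 0.
Proof.
have e : ltheta (1 * 1 : laurent C) = ltheta 1 * 1 + 1 * ltheta 1.
  exact: ltheta_leibniz.
rewrite !mulr1 mul1r in e.
by apply: (addrI (ltheta 1)); rewrite addr0 -e.
Qed.
End LaurentPrimitive.

(** * Regular singular connections *)

Section RegularSingular.
Variable C : fieldType.

Local Notation rs_mc := (@full_inclusion (MClaurent C) (@regular_singular C)).

Lemma rs_unit : exists A (e : nat -> (rs_mc (MCrs_unit C) : mc_obj _ _)),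
  tri_basis A 1 e.
Proof.
exists (fun _ _ => 0), (fun=> 1 : (laurent C)^o); split=> [[]//|m|a].
- by rewrite big_ord0 => _; apply: ltheta1.
- by exists (fun=> m); rewrite big_ord1 /= [_ *: _]mulr1.
- by rewrite big_ord1 [_ *: _]mulr1 => a0 [].
Qed.

(** The target is identified with the generic fibre of a lattice, where
    [lattice_proj_kernel] applies. *)
Lemma rs_coker (M N : MCrs C) (f : hom M N) :
  exists (Q : MCrs C) (g : hom N Q), forall y : (rs_mc N : mc_obj _ _),
    mc_fun (fmap rs_mc g) y = 0 <-> exists x, y = mc_fun (fmap rs_mc f) x.
Proof.
have [L [phi [psi [psi_phi phi_psi]]]] := svalP N.
pose f' : hom (sval M) (gamma C L) := comp phi f.
pose g : hom (sval N) (gamma C (lattice_quot f')) :=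
  comp (fmap (gamma C) (lattice_proj f')) phi.
exists (exist _ (gamma C (lattice_quot f')) (gamma_rs _)), g => y.
have psiK z : mc_fun psi (mc_fun phi z) = z.
  exact: (congr1 (fun h : hom (sval N) (sval N) => mc_fun h z) psi_phi).
split=> [/lattice_proj_kernel[x yx]|[x ->]].
  by exists x; rewrite -[y]psiK yx /= psiK.
by apply/lattice_proj_kernel; exists x.
Qed.
End RegularSingular.

(** * Constant sections of the Euler connection *)

Section GammaEul.
Variables (C : fieldType) (V : EndCat C).
Local Notation geul := (gamma_obj (eul_obj V)).

Definition geul_const (v : V) : geul := xfrac (ps_const v) 0.

Lemma geul_const_scale c v :
  geul_const (c *: v) = lconst c *: geul_const v.
Proof.
rewrite /geul_const [RHS]lconstZ; congr xfrac; apply/pseriesP => n.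
by rewrite [RHS]pcoefCZ /=; case: ifP; rewrite ?scaler0.
Qed.

Lemma geul_constD : {morph geul_const : v w / v + w}.
Proof.
move=> v w; rewrite /geul_const [RHS]xfracDk; congr xfrac.
by apply/pseriesP => n; rewrite pcoefD /=; case: ifP; rewrite ?addr0.
Qed.

Lemma geul_const0 : geul_const 0 = 0.
Proof. by apply: (addIr (geul_const 0)); rewrite -geul_constD !add0r. Qed.

Lemma geul_const_inj : injective geul_const.
Proof.
move=> v w e; apply/eqP; rewrite -subr_eq0; apply/eqP.
have : geul_const (v - w) = 0.
  by rewrite geul_constD e -geul_constD subrr geul_const0.
by move/xfrac_eq0/pseriesP/(_ 0%N).
Qed.

Lemma geul_nablaE (s : pseries V) k :
  mc_nabla (xfrac s k : geul) = xfrac (eul_nabla s - s *+ k) k.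
Proof. exact: xloc_nablaE (@eul_leibniz C V) _ _. Qed.

Lemma geul_const_nabla v :
  mc_nabla (geul_const v) = geul_const (end_map V v).
Proof.
rewrite geul_nablaE subr0; congr xfrac; apply/pseriesP => -[|n] /=.
  by rewrite add0r.
by rewrite mul0rn linear0 addr0.
Qed.

(** Coordinates are taken coefficient by coefficient. For independence, a
    relation is first put over a common denominator. *)
Lemma geul_tri_basis A n (u : nat -> V) :
  @tri_basis C C id (fun=> 0) (end_mc_obj V) A n u ->
  tri_basis A n (geul_const \o u).
Proof.
move=> [uA span free]; split=> [j lt_jn|m|a].
- rewrite [LHS]geul_const_nabla [end_map V _](uA j lt_jn).
  rewrite (big_morph _ geul_constD geul_const0).
  by apply: eq_bigr => i _; rewrite geul_const_scale.
- case: (xlocP m) => s k.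
  have /choice[c cE] : forall i, exists c : nat -> C,
      pcoef s i = \sum_(j < n) c j *: u j by move=> i; apply: span.
  exists (fun j => lfrac (Pseries (c^~ j)) k).
  rewrite (_ : s = \sum_(j < n) ps_tensor (Pseries (c^~ j)) (u j)); last first.
    apply/pseriesP => i; rewrite cE pcoef_sum.
    by apply: eq_bigr => j _; rewrite pcoef_tensor.
  rewrite xfrac_sum; apply: eq_bigr => j _.
  by rewrite [RHS]lfracZ addn0.
- have [k [f fa]] := common_denominator n a.
  rewrite (eq_bigr (fun i : 'I_n => xfrac (ps_tensor (f i) (u i)) k)); last first.
    by move=> i _; rewrite fa // [LHS]lfracZ addn0.
  rewrite -xfrac_sum => /xfrac_eq0/pseriesP f0 i lt_in; rewrite fa //.
  rewrite (_ : f i = 0); first exact: (@xfrac0 C (pseries C)^o).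
  apply/pseriesP => l; apply: (free (fun i => pcoef (f i) l)) lt_in.
  rewrite -[RHS](f0 l) pcoef_sum; apply: eq_bigr => j _.
  by rewrite pcoef_tensor.
Qed.

(** Each application of [end_map V] lowers the indices of the basis vectors
    that occur. *)
Lemma tri_nilpotent A n (u : nat -> V) :
  @tri_basis C C id (fun=> 0) (end_mc_obj V) A n u ->
  forall v, iter n (end_map V) v = 0.
Proof.
move=> [uA span _] v.
have iter_sum j m (a : nat -> C) : iter j (end_map V) (\sum_(i < m) a i *: u i)
    = \sum_(i < m) a i *: iter j (end_map V) (u i).
  elim: j => //= j ->; rewrite linear_sum.
  by apply: eq_bigr => i _; rewrite linearZ.
have iter_u j i : (i < j)%N -> (i < n)%N -> iter j (end_map V) (u i) = 0.
  elim: j i => // j IHj i lt_ij lt_in; rewrite iterSr [end_map V _](uA i lt_in).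
  rewrite iter_sum big1 // => l _; rewrite IHj ?scaler0 //.
    exact: leq_trans (ltn_ord l) lt_ij.
  exact: ltn_trans (ltn_ord l) lt_in.
have [a ->] := span v; rewrite [LHS]iter_sum big1 // => i _.
by rewrite iter_u ?scaler0.
Qed.

(** On the part of degree i = n - k, [mc_nabla] acts as [T n], that is, as
    [end_map V] + i. A vector killed by it would be an eigenvector of the
    nilpotent [end_map V] for the eigenvalue - i, so it vanishes unless i = 0. *)
Lemma geul_nilpotent_const N M (y : geul) :
  [pchar C] =i pred0 -> (forall v, iter N (end_map V) v = 0) ->
  iter M (@mc_nabla _ _ _ _ geul) y = 0 -> exists v, y = geul_const v.
Proof.
move=> charC nilV; case: (xlocP y) => s k.
have -> : iter M (@mc_nabla _ _ _ _ geul) (xfrac s k)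
    = xfrac (iter M (fun t => eul_nabla t - t *+ k) s) k.
  by elim: M => //= M ->; rewrite [LHS]geul_nablaE.
move=> /xfrac_eq0/pseriesP s0; exists (pcoef s k).
pose T n (v : V) : V := v *+ n + end_map V v - v *+ k.
have coefM (t : pseries V) m n : pcoef (t *+ m) n = pcoef t n *+ m.
  by elim: m => // m IHm; rewrite !mulrS pcoefD IHm.
have coefT n : pcoef (iter M (fun t => eul_nabla t - t *+ k) s) n
    = iter M (T n) (pcoef s n).
  by elim: (M) => //= m <-; rewrite coefM.
have T_inj n v : n != k -> T n v = 0 -> v = 0.
  move=> ne_nk Tv; pose c : C := k%:R - n%:R.
  have c0 : c != 0.
    by rewrite subr_eq0; apply: contraNneq ne_nk => /(natr_inj charC)->.
  have Av : end_map V v = c *: v.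
    apply/eqP; rewrite scalerBl !scaler_nat eq_sym subr_eq eq_sym addrC.
    by rewrite -subr_eq0; apply/eqP.
  have : iter N (end_map V) v = c ^+ N *: v.
    elim: (N) => [|m IHm]; first by rewrite scale1r.
    by rewrite iterS IHm linearZ /= Av scalerA -exprSr.
  rewrite nilV => /esym/eqP; rewrite scaler_eq0 expf_eq0 (negbTE c0) andbF.
  by move/eqP.
have sn n : n != k -> pcoef s n = 0.
  move=> ne; have := s0 n; rewrite coefT; elim: (M) => //= m IHm /(T_inj _ _ ne).
  exact: IHm.
rewrite /geul_const -[RHS](xfrac_cancel k) addn0; congr xfrac.
apply/pseriesP => n; rewrite pcoefXnZ /=; case: ltnP => [lt_nk|le_kn].
  by apply: sn; rewrite ltn_eqF.
rewrite subn_eq0; have [->|ne] := eqVneq n k; first by rewrite leqnn.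
by rewrite leqNgt ltn_neqAle eq_sym ne le_kn sn.
Qed.
End GammaEul.

(** * Full faithfulness *)

Section FullyFaithful.
Variable C : fieldType.

Lemma gamma_eul_const (V W : EndCat C) (phi : hom V W) v :
  mc_fun (fmap (gamma_eul C) phi) (geul_const v)
  = geul_const (end_fun phi v).
Proof.
rewrite [LHS](gamma_funE (fmap (eul C) phi)); congr xfrac.
by apply/pseriesP => n /=; case: ifP; rewrite ?linear0.
Qed.

Lemma gamma_eul_faithful (V W : EndCat C) (phi psi : hom V W) :
  fmap (gamma_eul C) phi = fmap (gamma_eul C) psi -> phi = psi.
Proof.
move=> e; apply: end_hom_eq; apply/lfunP => v; apply: geul_const_inj.
by rewrite -!gamma_eul_const e.
Qed.

(** [Phi] maps constants to vectors killed by a power of [mc_nabla], which are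
    constants again; this gives the arrow, and the two agree on a basis made of
    constants. *)
Lemma gamma_eul_full (V W : EndCat C) A n (u : nat -> V) B m (w : nat -> W)
    (Phi : hom (gamma_eul C V) (gamma_eul C W)) :
  [pchar C] =i pred0 ->
  @tri_basis C C id (fun=> 0) (end_mc_obj V) A n u ->
  @tri_basis C C id (fun=> 0) (end_mc_obj W) B m w ->
  exists phi : hom V W, fmap (gamma_eul C) phi = Phi.
Proof.
move=> charC uA wB.
pose F : mc_hom (gamma_obj (eul_obj V)) (gamma_obj (eul_obj W)) := Phi.
have /choice[phi phiE] : forall v, exists w',
    mc_fun F (geul_const v) = geul_const w'.
  move=> v; apply: (geul_nilpotent_const (M := n) charC (tri_nilpotent wB)).
  have -> : iter n (@mc_nabla _ _ _ _ (gamma_obj (eul_obj W)))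
      (mc_fun F (geul_const v)) = mc_fun F (geul_const (iter n (end_map V) v)).
    by elim: (n) => // k IHk; rewrite !iterS IHk -geul_const_nabla mc_fun_nabla.
  by rewrite (tri_nilpotent uA) geul_const0 mc_fun0.
have phi_lin : linear phi.
  move=> c x y; apply: geul_const_inj.
  by rewrite -phiE !geul_constD !geul_const_scale mc_fun_linear !phiE.
pose f := linfun (HB.pack_for {linear V -> W} phi
                   (GRing.isLinear.Build _ _ _ _ phi phi_lin)).
have fE v : f v = phi v by rewrite lfunE.
have fP : (end_map W \o f = f \o end_map V)%VF.
  apply/lfunP => v; rewrite !comp_lfunE !fE; apply: geul_const_inj.
  by rewrite -geul_const_nabla -!phiE -geul_const_nabla mc_fun_nabla.
exists (EndHom fP : hom V W).
apply: (mc_hom_ext (geul_tri_basis uA)) => j _.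
by rewrite [LHS]gamma_eul_const [RHS]phiE /= fE.
Qed.
End FullyFaithful.

(** * The equivalence on unipotent objects *)

Lemma lconst1 (C : fieldType) : lconst (1 : C) = 1.
Proof. by []. Qed.

Lemma end_primitive (C : fieldType) (g : C) :
  exists c h : C, g = c + (fun=> 0) h.
Proof. by exists g, 0; rewrite addr0. Qed.

Section UnipotentBases.
Variable C : fieldType.
Hypothesis charC : [pchar C] =i pred0.

Lemma End_unipotentP (V : EndCat C) : End_unipotent V <->
  exists A n u, @tri_basis C C id (fun=> 0) (end_mc_obj V) A n u.
Proof.
split=> [|[A [n [u uA]]]].
  exact: (unipotent_tri (erefl _) (erefl _) (@end_primitive C)
    (@end_mc_full C) (@end_mc_faithful C) (@end_mc_unit C) (@end_mc_tri C)
    (@end_mc_coker C)).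
exact: (tri_unipotent (erefl _) (@end_mc_full C) (@end_mc_faithful C)
  (@end_mc_unit C) (@end_mc_tri C) uA).
Qed.

Local Notation rs_mc := (@full_inclusion (MClaurent C) (@regular_singular C)).

Lemma rs_full (M N : MCrs C) (g : hom (rs_mc M) (rs_mc N)) :
  exists f : hom M N, fmap rs_mc f = g.
Proof. by exists g. Qed.

Lemma rs_faithful (M N : MCrs C) (f g : hom M N) :
  fmap rs_mc f = fmap rs_mc g -> f = g.
Proof. by []. Qed.

Lemma rs_tri (A : nat -> nat -> C) n :
  exists (T : MCrs C) (u : nat -> (rs_mc T : mc_obj _ _)), tri_basis A n u.
Proof.
have [V [u uA]] := end_mc_tri A n.
by exists (gamma_eul C V), (@geul_const C V \o u); apply: geul_tri_basis.
Qed.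

Lemma MCrs_unipotentP (M : MCrs C) : MCrs_unipotent M <->
  exists A n u, @tri_basis C (laurent C) (@lconst C) (@ltheta C) (sval M) A n u.
Proof.
split=> [|[A [n [u uA]]]].
  exact: (unipotent_tri (lconst1 C) (ltheta1 C) (laurent_primitive charC)
    rs_full rs_faithful (@rs_unit C) rs_tri (@rs_coker C)).
exact: (tri_unipotent (lconst1 C) rs_full rs_faithful (@rs_unit C) rs_tri uA).
Qed.
End UnipotentBases.

Theorem theorem5p4 (C : closedFieldType) (charC : [pchar C] =i pred0) :
  exists unip : forall X : EndCat C,
      End_unipotent X -> MCrs_unipotent (gamma_eul C X),
    @is_equivalence (full_subcategory (@End_unipotent C))
      (full_subcategory (@MCrs_unipotent C))
      (functor_restrict unip).
Proof.
have unip (X : EndCat C) : End_unipotent X -> MCrs_unipotent (gamma_eul C X).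
  case/End_unipotentP => A [n [u uA]]; apply/(MCrs_unipotentP charC).
  by exists A, n, (@geul_const C X \o u); apply: geul_tri_basis.
exists unip; apply: ff_es_equivalence.
- move=> [V V_unip] [W W_unip] Phi.
  have [A [n [u uA]]] := (End_unipotentP V).1 V_unip.
  have [B [m [w wB]]] := (End_unipotentP W).1 W_unip.
  have [phi phiE] := gamma_eul_full Phi charC uA wB.
  by exists phi.
- by move=> [V V_unip] [W W_unip] phi psi; apply: gamma_eul_faithful.
- move=> [M M_unip].
  have [A [n [v vA]]] := (MCrs_unipotentP charC M).1 M_unip.
  have [V [u uA]] := end_mc_tri A n.
  have V_unip : End_unipotent V by apply/End_unipotentP; exists A, n, u.
  exists (exist _ V V_unip).
  exact: (tri_isomorphic (lconst1 C) (@rs_full C) (@rs_faithful C)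
    (geul_tri_basis uA : tri_basis (M := sval (gamma_eul C V)) A n _) vA).
Qed.
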